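(* Let $\ell$ be a positive odd integer having at most two distinct prime factors. Then for every positive integer $n$, the product $\Omega_\ell(n)=(1^\ell+1)(2^\ell+1)\cdots(n^\ell+1)$ is not a powerful number.
   Context: A positive integer $a$ is called a powerful number if for every prime $p$, $p\mid a$ implies $p^2\mid a$. For a positive integer $\ell$ and positive integer $n$, $\Omega_\ell(n)=\prod_{a=1}^{n}(a^\ell+1)$. *)

(* Defs.v *)
From mathcomp Require Import all_boot.
Set Implicit Arguments. Unset Strict Implicit. Unset Printing Implicit Defensive.

Definition powerful (a : nat) : Prop :=
  0 < a /\ forall p : nat, prime p -> p %| a -> p ^ 2 %| a.

Definition Omega (l n : nat) : nat := \prod_(1 <= a < n.+1) (a ^ l + 1).

(* Main.v *)
From Stdlib Require Import Reals Lra ZArith NArith.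
Require Import Defs.
From mathcomp Require Import all_boot all_algebra finfield zify.
Set Implicit Arguments. Unset Strict Implicit. Unset Printing Implicit Defensive.

(** Put [N = n + 1].  A prime [p] with [N/2 < p <= N] and [l] coprime to
    [p(p - 1)] divides exactly one factor, the one with [a = p - 1], and divides
    it only once.  If no such prime exists, every prime of [(N/2, N]] is equal to,
    or congruent to 1 modulo, one of the at most two primes dividing [l].

    For large [N] this contradicts Chebyshev-type estimates.  If 3 is one of these two
    primes, only the primes [p = 2 mod 3] are used, otherwise all primes are.  Their
    contribution to [(x/2, x]] is bounded below by comparing quotients of products
    of [P_c(y)], the product of the [n <= y] with [n = c mod 3].  The primes that
    are 1 modulo [q] are bounded above by noting that the part of [K!] prime to
    [M = 6q] divides the product of any [K] consecutive terms of an arithmetic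
    progression of difference [M], while the primes in question divide it too.

    For [23 <= N < 2^24] it suffices to exhibit three primes of [(N/2, N]] such
    that no odd prime divides two of the numbers [p(p - 1)].  For [n <= 21] one
    sometimes needs a prime [p] with [gcd(l, p - 1) > 1]. *)

(** * Primes dividing the product exactly once *)

Section Arith.
Import GRing.Theory.
Local Open Scope ring_scope.

Lemma expr_gcd_eq1 (F : fieldType) (x : F) (m n : nat) :
  (0 < m)%N -> x ^+ m = 1 -> x ^+ n = 1 -> x ^+ gcdn m n = 1.
Proof.
move=> m_gt0 xm xn; case: (egcdnP n m_gt0) => u v uv _.
rewrite -[LHS]mul1r -{1}(expr1n F v) -{1}xn -exprM [(n * v)%N]mulnC -exprD.
by rewrite -uv mulnC exprM xm expr1n.
Qed.

(** Since [l] is odd, [p] divides [a ^ l + 1] iff [(- a) ^ l = 1] in ['F_p]. Fermat gives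
    [(- a) ^ p.-1 = 1] for nonzero [a], so by Bezout only the gcd of the two exponents matters. *)
Lemma dvdn_expD1_gcd (p l a : nat) : prime p -> odd l ->
  (p %| a ^ l + 1)%N = (p %| a ^ gcdn l p.-1 + 1)%N.
Proof.
move=> p_pr l_odd; have l_gt0 : (0 < l)%N by case: l l_odd.
have d_odd : odd (gcdn l p.-1) by apply: dvdn_odd (dvdn_gcdl _ _) l_odd.
have chp := pchar_Fp p_pr.
have E k : odd k -> (p %| a ^ k + 1)%N = ((- a%:R : 'F_p) ^+ k == 1).
  move=> k_odd; rewrite (dvdn_pcharf chp) natrD natrX exprNn -signr_odd k_odd expr1.
  by rewrite mulN1r eqr_oppLR addr_eq0.
rewrite !E //; apply/eqP/eqP => [xl|xd]; last first.
  have /dvdnP[k ->] := dvdn_gcdl l p.-1.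
  by rewrite mulnC exprM xd expr1n.
apply: expr_gcd_eq1 => //.
have x0 : (- a%:R : 'F_p) != 0.
  apply/eqP => x0; move: xl; rewrite x0 expr0n.
  by case: (l) l_gt0 => // ? _ /esym/eqP; rewrite oner_eq0.
have := @expf_card _ (- a%:R : 'F_p); rewrite card_Fp // => H.
by apply: (mulfI x0); rewrite mulr1 -exprS prednK ?prime_gt0.
Qed.

Lemma expr_1B (u : int) (e : nat) :
  exists z, (1 - u) ^+ e = 1 - e%:Z * u + u * u * z.
Proof.
elim: e => [|e [z IH]]; first by exists 0; rewrite expr0; lia.
by exists (e%:Z + z - u * z); rewrite exprS IH; nia.
Qed.

(** With [a ^ d = p t - 1] and [e] odd, [a ^ (d * e) + 1] is [e p t] modulo [p ^ 2]. Hence [p]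
    divides [e t], and therefore [t]. *)
Lemma dvdn_sqr_expD1 (p d e a : nat) : prime p -> odd e -> ~~ (p %| e)%N ->
  (p %| a ^ d + 1)%N -> (p ^ 2 %| a ^ (d * e) + 1)%N -> (p ^ 2 %| a ^ d + 1)%N.
Proof.
move=> p_pr e_odd pe /dvdnP[t Et].
have Ea : ((a ^ d)%N%:Z = - (1 - p%:Z * t%:Z)) by lia.
have [z Ez] := expr_1B (p%:Z * t%:Z) e.
have Eae : ((a ^ (d * e) + 1)%N%:Z = e%:Z * (p%:Z * t%:Z) - p%:Z * t%:Z * (p%:Z * t%:Z) * z).
  rewrite expnM PoszD -[Posz ((a ^ d) ^ e)]/(((a ^ d) ^ e)%N%:Z).
  have -> : ((a ^ d) ^ e)%N%:Z = (a ^ d)%N%:Z ^+ e by rewrite -natz natrX natz.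
  by rewrite Ea exprNn -signr_odd e_odd expr1 Ez; lia.
rewrite Et => H.
have : ((p ^ 2)%N%:Z %| (a ^ (d * e) + 1)%N%:Z)%Z by [].
rewrite Eae => /dvdzP[w Ew].
have p_gt0 := prime_gt0 p_pr.
have Ep : (p ^ 2)%N%:Z = p%:Z * p%:Z by rewrite -mulnn.
have Ew' : e%:Z * t%:Z = p%:Z * (w + t%:Z * t%:Z * z).
  apply: (@mulfI _ p%:Z); first by lia.
  by move: Ew; rewrite Ep; nia.
have : (p%:Z %| (e * t)%N%:Z)%Z by rewrite PoszM Ew'; apply: dvdz_mulr.
rewrite dvdzE /= (Euclid_dvdM e t p_pr) (negPf pe) /= => pt.
by rewrite mulnC -mulnn dvdn_mul.
Qed.

End Arith.

Lemma logn_prod_seq (I : Type) (r : seq I) (P : pred I) (F : I -> nat) p :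
  (forall i, P i -> 0 < F i) ->
  logn p (\prod_(i <- r | P i) F i) = \sum_(i <- r | P i) logn p (F i).
Proof.
move=> F0; elim: r => [|i r IH]; first by rewrite !big_nil logn1.
rewrite !big_cons; case: ifP => // Pi.
by rewrite lognM ?F0 ?IH //; apply/prodn_cond_gt0.
Qed.

(** The factor of index [a] has [p]-adic valuation 1 and all others have valuation 0. As [p] does
    not divide [l], both facts can be tested with the small exponent [gcdn l p.-1]. *)
Lemma not_powerful_of_single (l n p a : nat) : odd l -> prime p -> ~~ (p %| l) ->
  0 < a <= n ->
  (p %| a ^ gcdn l p.-1 + 1) -> ~~ (p ^ 2 %| a ^ gcdn l p.-1 + 1) ->
  (forall b, 0 < b <= n -> p %| b ^ gcdn l p.-1 + 1 -> b = a) ->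
  ~ powerful (Omega l n).
Proof.
move=> l_odd p_pr pl /andP[a0 an] pa p2a uniq [O0 Opow].
have [e El] : exists e, l = gcdn l p.-1 * e.
  by have /dvdnP[e He] := dvdn_gcdl l p.-1; exists e; rewrite mulnC.
have e_odd : odd e by move: l_odd; rewrite {1}El oddM => /andP[].
have pe : ~~ (p %| e) by apply: contra pl => pe; rewrite El dvdn_mull.
have Fa : logn p (a ^ l + 1) = 1.
  apply/eqP; rewrite eqn_leq -[X in _ && X](pfactor_dvdn 1 p_pr) ?addn1 // expn1 -[(a ^ l).+1]addn1.
  rewrite dvdn_expD1_gcd // pa andbT leqNgt.
  rewrite -(pfactor_dvdn 2 p_pr) ?addn1 // -[(a ^ l).+1]addn1.
  by apply: contra p2a => H; apply: (dvdn_sqr_expD1 p_pr e_odd pe pa); rewrite -El.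
have Fb b : 0 < b <= n -> b != a -> logn p (b ^ l + 1) = 0.
  move=> bn ba; apply/eqP; rewrite eqn0Ngt logn_gt0 mem_primes p_pr addn1 /= -[(b ^ l).+1]addn1.
  by rewrite dvdn_expD1_gcd //; apply: contra ba => pb; apply/eqP/uniq.
have L1 : logn p (Omega l n) = 1.
  rewrite /Omega logn_prod_seq; last by move=> i _; rewrite addn1.
  rewrite (bigD1_seq a) /= ?iota_uniq ?mem_index_iota ?a0 ?ltnS //= Fa big1_seq ?addn0 //.
  by move=> b /andP[ba]; rewrite mem_index_iota ltnS => bn; apply: Fb.
have pO : p %| Omega l n.
  by have := pfactor_dvdn 1 p_pr O0; rewrite expn1 L1 => ->.
by have := Opow _ p_pr pO; rewrite pfactor_dvdn // L1.
Qed.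

Lemma not_powerful_of_prime (l n p : nat) : odd l -> prime p ->
  coprime l (p * p.-1) -> p <= n.+1 -> n.+1 < 2 * p -> ~ powerful (Omega l n).
Proof.
move=> l_odd p_pr; rewrite coprimeMr => /andP[lp lp1] pn np.
have p_gt1 := prime_gt1 p_pr.
have d1 : gcdn l p.-1 = 1 by apply/eqP.
apply: (@not_powerful_of_single l n p p.-1); rewrite ?d1 ?expn1 ?addn1 ?prednK //.
- by rewrite -prime_coprime // coprime_sym.
- by lia.
- by lia.
- by apply/negP => /(dvdn_leq (prime_gt0 p_pr)); rewrite -mulnn; nia.
- by lia.
- move=> b /andP[b0 bn] pb; rewrite expn1 in pb.
  have /dvdnP[k Ek] : p %| b.+1 by rewrite -addn1.
  have k1 : k = 1 by nia.
  by rewrite k1 mul1n in Ek; rewrite -Ek.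
Qed.

(** * Small [n] *)

(** Moves divisibility to binary numbers, where the numerical tests can be evaluated. *)
Lemma dvdn_to_nat (P X : N) : P <> 0%num ->
  (N.to_nat P %| N.to_nat X) = N.eqb (N.modulo X P) 0.
Proof.
move=> P0; apply/idP/idP => [/dvdnP[k Ek]|/N.eqb_eq E].
  apply/N.eqb_eq; have -> : X = (N.of_nat k * P)%num by lia.
  by rewrite N.Div0.mod_mul.
apply/dvdnP; exists (N.to_nat (N.div X P)).
have := N.div_mod X P P0; lia.
Qed.

Fixpoint trial_division (fuel : nat) (d P : N) : bool :=
  if N.ltb P (d * d) then true
  else if fuel is f.+1 then ~~ N.eqb (N.modulo P d) 0 && trial_division f (d + 1) P
  else false.

Lemma trial_divisionP fuel d P : d <> 0%num -> trial_division fuel d P ->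
  forall e, (d <= e)%num -> (e * e <= P)%num -> N.modulo P e <> 0%num.
Proof.
elim: fuel d => [|f IH] d d0 /=; case: ifP => [/N.ltb_spec0 lt _ e de ee|_ //]; try by nia.
move=> /andP[Pd /IH H] e de ee.
have [ed|ed] : e = d \/ (d + 1 <= e)%num by lia.
  by rewrite ed => E; rewrite E in Pd.
by apply: H => //; lia.
Qed.

(** The fuel lets the trial divisors reach 5000, whose square exceeds [2 ^ 24]. *)
Definition primeN (P : N) : bool := N.leb 2 P && trial_division 5000 2 P.

Lemma primeNP P : primeN P -> prime (N.to_nat P).
Proof.
case/andP => /N.leb_spec0 P2 /trial_divisionP H.
apply: contraT => /primePns[|[p [p_pr pp pP]]]; first by lia.
have p2 := prime_gt1 p_pr.
have E : N.modulo P (N.of_nat p) = 0%num.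
  by apply/N.eqb_eq; rewrite -dvdn_to_nat ?Nat2N.id //; lia.
by rewrite -mulnn in pp; exfalso; apply: (H _ (N.of_nat p) _ _ E) => //; lia.
Qed.

Lemma three_primes_ndvd (l s t u : nat) : 0 < l -> size (primes l) <= 2 ->
  prime s -> prime t -> prime u -> s != t -> s != u -> t != u ->
  s %| l -> t %| l -> u %| l -> False.
Proof.
move=> l0 sz s_pr t_pr u_pr st su tu sl tl ul.
have : size [:: s; t; u] <= size (primes l).
  apply: uniq_leq_size; first by rewrite /= !inE negb_or st su tu.
  by move=> v; rewrite !inE => /or3P[] /eqP->; rewrite mem_primes l0 ?s_pr ?t_pr ?u_pr.
by rewrite leqNgt ltnS sz.
Qed.

Lemma noncoprime_prime (l m : nat) : 0 < l -> ~~ coprime l m ->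
  exists s, [/\ prime s, s %| l & s %| m].
Proof.
move=> l0; rewrite /coprime => g1.
have g0 : 0 < gcdn l m by rewrite gcdn_gt0 l0.
exists (pdiv (gcdn l m)).
rewrite pdiv_prime; last by case: (gcdn l m) g0 g1 => [|[]].
by split=> //; apply: dvdn_trans (pdiv_dvd _) _; rewrite ?dvdn_gcdl ?dvdn_gcdr.
Qed.

(** Since the gcd is a power of two, no odd prime divides both numbers. *)
Definition indep (p q : N) : bool :=
  N.eqb (N.modulo (2 ^ 64) (N.gcd (p * (p - 1)) (q * (q - 1)))) 0.

Lemma expn_to_nat (a d : N) : N.to_nat (a ^ d) = N.to_nat a ^ N.to_nat d.
Proof.
rewrite N2Nat.inj_pow; elim: (N.to_nat d) => [|k IH] //.
by rewrite expnS -IH.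
Qed.

Lemma indepP p q s : (1 < p)%num -> indep p q -> prime s ->
  s %| N.to_nat p * (N.to_nat p).-1 -> s %| N.to_nat q * (N.to_nat q).-1 -> s = 2.
Proof.
move=> p1 /N.eqb_eq E s_pr sp sq.
have s2 := prime_gt1 s_pr.
have to_natE x : N.to_nat x * (N.to_nat x).-1 = N.to_nat (x * (x - 1)) by lia.
have Es : s = N.to_nat (N.of_nat s) by lia.
have sN0 : N.of_nat s <> 0%num by lia.
have toD x : s %| N.to_nat x * (N.to_nat x).-1 -> N.divide (N.of_nat s) (x * (x - 1)).
  by rewrite to_natE {1}Es dvdn_to_nat // => /N.eqb_eq/N.Lcm0.mod_divide.
have /N.gcd_greatest/(_ (toD _ sq)) sg := toD _ sp.
have g0 : N.gcd (p * (p - 1)) (q * (q - 1)) <> 0%num.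
  by move=> /N.gcd_eq_0_l; nia.
have s264 := N.divide_trans _ _ _ sg (proj1 (N.Lcm0.mod_divide _ _) E).
have : s %| 2 ^ 64.
  have -> : 2 ^ 64 = N.to_nat (2 ^ 64) by rewrite expn_to_nat.
  by rewrite Es dvdn_to_nat //; apply/N.eqb_eq/N.Lcm0.mod_divide.
by rewrite Euclid_dvdX // andbT dvdn_prime2 // => /eqP.
Qed.

Definition triple_ok (lo : N) (t : N * N * N) : bool :=
  let: (p, q, r) := t in
  [&& N.ltb p q, N.ltb q r, N.leb r lo, primeN p, primeN q, primeN r,
      indep p q, indep p r & indep q r].

(** A triple with least prime [p] serves all [n] from [lo] up to [2 * p], where the next triple
    takes over. *)
Fixpoint chain_ok (lo hi : N) (s : seq (N * N * N)) : bool :=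
  if s is t :: s' then triple_ok lo t && chain_ok (2 * t.1.1) hi s' else N.leb hi lo.

(** If all three primes fail, each yields a prime divisor of [l]. These divisors are odd, hence
    pairwise distinct by [indep], and there is one too many. *)
Lemma good_prime_of_triple (l n : nat) (lo p q r : N) : odd l -> size (primes l) <= 2 ->
  triple_ok lo (p, q, r) -> (lo <= N.of_nat n)%num -> (N.of_nat n < 2 * p)%num ->
  exists x, [/\ prime x, coprime l (x * x.-1), x <= n & n < 2 * x].
Proof.
move=> l_odd sz; case/and5P => /N.ltb_spec0 pq /N.ltb_spec0 qr /N.leb_spec0 rlo.
move=> /[dup] /andP[/N.leb_spec0 p2 _] /primeNP p_pr.
case/and5P => /primeNP q_pr /primeNP r_pr Ipq Ipr Iqr lon n2p.
have l0 : 0 < l by case: l l_odd {sz}.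
have [pq' qr'] := (N.lt_le_incl _ _ pq, N.lt_le_incl _ _ qr).
have pr := N.le_trans _ _ _ pq' qr'.
have good x : prime (N.to_nat x) -> (p <= x)%num -> (x <= r)%num ->
    coprime l (N.to_nat x * (N.to_nat x).-1) ->
    exists p, [/\ prime p, coprime l (p * p.-1), p <= n & n < 2 * p].
  move=> x_pr px xr co; exists (N.to_nat x); split => //; lia.
case: (boolP (coprime l (N.to_nat p * (N.to_nat p).-1))) => [|/(noncoprime_prime l0)[s [s_pr sl sp]]].
  exact: good p_pr (N.le_refl p) pr.
case: (boolP (coprime l (N.to_nat q * (N.to_nat q).-1))) => [|/(noncoprime_prime l0)[t [t_pr tl tq]]].
  exact: good q_pr pq' qr'.
case: (boolP (coprime l (N.to_nat r * (N.to_nat r).-1))) => [|/(noncoprime_prime l0)[u [u_pr ul ur]]].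
  exact: good r_pr pr (N.le_refl r).
have two x : x %| l -> x != 2.
  by move=> xl; apply/eqP => x2; move: xl; rewrite x2 dvdn2 l_odd.
exfalso; apply: (@three_primes_ndvd l s t u) => //; apply/eqP => E; subst.
- by move/eqP: (two _ sl); apply; apply: indepP Ipq _ sp tq => //; lia.
- by move/eqP: (two _ sl); apply; apply: indepP Ipr _ sp ur => //; lia.
- by move/eqP: (two _ tl); apply; apply: indepP Iqr _ tq ur => //; lia.
Qed.

Lemma good_prime_of_chain (l n : nat) (lo hi : N) s : odd l -> size (primes l) <= 2 ->
  chain_ok lo hi s -> (lo <= N.of_nat n)%num -> (N.of_nat n < hi)%num ->
  exists p, [/\ prime p, coprime l (p * p.-1), p <= n & n < 2 * p].
Proof.
move=> l_odd sz; elim: s lo => [|[[p q] r] s IH] lo; first by move/N.leb_spec0; lia.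
case/andP => tok ch lon nhi.
have [lt|ge] := N.lt_ge_cases (N.of_nat n) (2 * p).
  exact: good_prime_of_triple tok lon lt.
exact: IH ch ge nhi.
Qed.

Lemma good_prime_small (l n : nat) : odd l -> size (primes l) <= 2 ->
  (23 <= N.of_nat n)%num -> (N.of_nat n < 2 ^ 24)%num ->
  exists p, [/\ prime p, coprime l (p * p.-1), p <= n & n < 2 * p].
Proof.
move=> l_odd sz.
have ch : chain_ok 23 (2 ^ 24)
  [:: (17, 19, 23); (23, 29, 31); (29, 37, 41); (43, 47, 53); (71, 79, 83);
      (131, 137, 139); (239, 251, 257); (461, 463, 467); (887, 911, 919);
      (1721, 1733, 1759); (3391, 3407, 3413); (6761, 6763, 6779);
      (13487, 13499, 13513); (26927, 26951, 26959); (53819, 53831, 53849);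
      (107603, 107609, 107621); (215153, 215183, 215197);
      (430277, 430289, 430303); (860513, 860533, 860543);
      (1721003, 1721009, 1721023); (3441953, 3441959, 3441989);
      (6883763, 6883841, 6883897); (13767493, 13767497, 13767521)]%num.
  by vm_cast_no_check (erefl true).
exact (good_prime_of_chain l_odd sz ch).
Qed.

(** Here [d] is meant to be [gcdn l p.-1]. All indices up to [m] are tested, so one evaluation
    serves every [n] with [a <= n <= m]. *)
Definition single_hit (p d m a : nat) : bool :=
  let hit b q := N.eqb (N.modulo (N.of_nat b ^ N.of_nat d + 1) q) 0 in
  all (fun b => hit b (N.of_nat p) == (b == a)) (iota 1 m) &&
  ~~ hit a (N.of_nat p ^ 2)%num.

Lemma not_powerful_of_single_hit (l n p d m a : nat) : odd l -> prime p ->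
  ~~ (p %| l) -> d %| l -> d %| p.-1 -> coprime l (p.-1 %/ d) -> 0 < a <= n -> n <= m ->
  single_hit p d m a -> ~ powerful (Omega l n).
Proof.
move=> l_odd p_pr pl dl dp co an nm /andP[/allP uniq p2].
have p0 : N.of_nat p <> 0%num by move: (prime_gt0 p_pr); lia.
have gE : gcdn l p.-1 = d.
  by rewrite -(divnK dp) mulnC Gauss_gcdl // gcdnC; apply/gcdn_idPl.
have hitE b q : N.of_nat q <> 0%num ->
    N.eqb (N.modulo (N.of_nat b ^ N.of_nat d + 1) (N.of_nat q)) 0 = (q %| b ^ d + 1).
  by move=> q0; rewrite -dvdn_to_nat // N2Nat.inj_add expn_to_nat !Nat2N.id.
have uniqE b : 0 < b <= n -> (p %| b ^ d + 1) = (b == a).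
  by move=> bn; rewrite -hitE //; apply/eqP/uniq; rewrite mem_iota; lia.
apply: (@not_powerful_of_single l n p a) => //; rewrite ?gE.
- by rewrite uniqE.
- have -> : p ^ 2 = N.to_nat (N.of_nat p ^ 2) by rewrite expn_to_nat Nat2N.id.
  have q0 : N.of_nat (N.to_nat (N.of_nat p ^ 2)) <> 0%num.
    by rewrite N2Nat.id; apply: N.pow_nonzero.
  by rewrite -hitE // N2Nat.id.
- by move=> b bn pb; apply/eqP; rewrite -uniqE.
Qed.

(** The cases follow which small primes divide [l]. Each prime that fails because it divides [l]
    uses up one of the two possible prime divisors; once two are known, [third] excludes all
    others. *)
Lemma not_powerful_small (l n : nat) : odd l -> size (primes l) <= 2 -> 0 < n -> n <= 21 ->
  ~ powerful (Omega l n).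
Proof.
move=> l_odd sz n0 n21.
have l0 : 0 < l by case: l l_odd {sz}.
have c2 k : coprime l (2 ^ k).
  by case: k => [|k]; rewrite ?expn0 ?coprimen1 // coprime_pexpr // coprimen2.
have nc p : prime p -> coprime l p = ~~ (p %| l).
  by move=> p_pr; rewrite coprime_sym prime_coprime.
have cM a b : coprime l a -> coprime l b -> coprime l (a * b).
  by move=> la lb; rewrite coprimeMr la.
have cp p : prime p -> ~~ (p %| l) -> coprime l p by move=> p_pr; rewrite nc.
have third s t u : prime s -> prime t -> prime u -> s != t -> s != u -> t != u ->
    s %| l -> t %| l -> ~~ (u %| l).
  move=> s_pr t_pr u_pr st su tu sl tl; apply/negP.
  exact: (three_primes_ndvd l0 sz s_pr t_pr u_pr st su tu sl tl).
have good p := @not_powerful_of_prime l n p l_odd.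
have hit p d m a := @not_powerful_of_single_hit l n p d m a l_odd.
have [n2|n2] := leqP n 2.
  by apply: (good 2) => //; try (by lia); exact: (c2 1).
have [d3|nd3] := boolP (3 %| l).
  have hit7 : ~~ (7 %| l) -> n <= 4 -> ~ powerful (Omega l n).
    by move=> d7 n4; apply: (hit 7 3 4 3) => //; try (by lia); exact: (c2 1).
  have hit31 : 6 <= n -> ~~ (5 %| l) -> ~~ (31 %| l) -> ~ powerful (Omega l n).
    move=> n6 d5 d31; apply: (hit 31 3 25 6) => //; try by lia.
    by apply: (cM (2 ^ 1) 5) => //; apply: cp.
  have [n3|n3] := leqP n 3.
    have [d7|] := boolP (7 %| l); last by move=> d7; apply: hit7 => //; lia.
    (* [546 = 2 * 3 * 7 * 13] has gcd 21 with [l], and [3 ^ 7 + 1 = 4 * 547]. *)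
    apply: (hit 547 21 3 3) => //; try by lia.
    - exact: (third 3 7 547).
    - by apply: (cM (2 ^ 1) 13) => //; apply: cp => //; apply: (third 3 7 13).
  have [n9|n9] := leqP n 9.
    have [d13|d13] := boolP (13 %| l); last first.
      by apply: (hit 13 3 9 4) => //; try (by lia); exact: (c2 2).
    have [n4|n4] := leqP n 4; first by apply: hit7 => //; apply: (third 3 13 7).
    have [n5|n5] := leqP n 5.
      apply: (good 5) => //; try by lia.
      by apply: (cM 5 (2 ^ 2)) => //; apply: cp => //; apply: (third 3 13 5).
    by apply: hit31 => //; apply: (third 3 13).
  have hit43 : ~~ (7 %| l) -> ~~ (43 %| l) -> ~ powerful (Omega l n).
    move=> d7 d43; apply: (hit 43 3 36 7) => //; try by lia.
    by apply: (cM (2 ^ 1) 7) => //; apply: cp.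
  have [d5|d5] := boolP (5 %| l); first by apply: hit43; apply: (third 3 5).
  have [d31|d31] := boolP (31 %| l); first by apply: hit43; apply: (third 3 31).
  by apply: hit31 => //; lia.
have [n3|n3] := leqP n 3.
  apply: (good 3) => //; try by lia.
  by apply: (cM 3 (2 ^ 1)) => //; apply: cp.
have [n16|n16] := leqP 16 n.
  have [n20|n20] := leqP n 20.
    (* The primes are needed for [n.+1], which lies between 17 and 21, below [2 * 11]. *)
    have tok : triple_ok 17 (11, 13, 17)%num by vm_cast_no_check (erefl true).
    have [||p [p_pr co pn np]] := @good_prime_of_triple l n.+1 _ _ _ _ l_odd sz tok; try lia.
    exact: (good p).
  have [d13|d13] := boolP (13 %| l); last first.
    apply: (good 13) => //; try by lia.
    by apply: (cM 13 (2 ^ 2 * 3)); [|apply: (cM _ _) => //]; apply: cp.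
  have [d17|d17] := boolP (17 %| l); last first.
    apply: (good 17) => //; try by lia.
    by apply: (cM 17 (2 ^ 4)) => //; apply: cp.
  have d19 : ~~ (19 %| l) by apply: (third 13 17).
  apply: (good 19) => //; try by lia.
  by apply: (cM 19 (2 ^ 1 * (3 * 3))); [|apply: (cM _ _) => //; apply: (cM _ _)]; apply: cp.
(* From here on 3 does not divide [l] and [4 <= n <= 15]. *)
have [d5|d5] := boolP (5 %| l).
  have [d41|d41] := boolP (41 %| l); last first.
    by apply: (hit 41 5 15 4) => //; try (by lia); exact: (c2 3).
  apply: (hit 61 5 15 3) => //; try by lia.
  - exact: (third 5 41 61).
  - by apply: (cM (2 ^ 2) 3) => //; apply: cp.
have [n8|n8] := leqP n 8.
  apply: (good 5) => //; try by lia.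
  by apply: (cM 5 (2 ^ 2)) => //; apply: cp.
have good11 : 10 <= n -> ~~ (11 %| l) -> ~ powerful (Omega l n).
  move=> n10 d11; apply: (good 11) => //; try by lia.
  by apply: (cM 11 (2 ^ 1 * 5)); [|apply: (cM _ _) => //]; apply: cp.
have good13 : 12 <= n -> ~~ (13 %| l) -> ~ powerful (Omega l n).
  move=> n12 d13; apply: (good 13) => //; try by lia.
  by apply: (cM 13 (2 ^ 2 * 3)); [|apply: (cM _ _) => //]; apply: cp.
have [n12|n12] := leqP n 12.
  have [d7|d7] := boolP (7 %| l); last first.
    apply: (good 7) => //; try by lia.
    by apply: (cM 7 (2 ^ 1 * 3)); [|apply: (cM _ _) => //]; apply: cp.
  have hit449 : ~~ (449 %| l) -> ~ powerful (Omega l n).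
    by move=> d449; apply: (hit 449 7 12 5) => //; try (by lia); exact: (c2 6).
  have [n9|n9] := leqP n 9.
    have [d449|] := boolP (449 %| l); last exact: hit449.
    apply: (hit 547 7 9 3) => //; try by lia.
    - exact: (third 7 449 547).
    - apply: (cM (2 ^ 1 * 3) 13); last by apply: cp => //; apply: (third 7 449 13).
      by apply: (cM _ _) => //; apply: cp.
  have [d11|] := boolP (11 %| l); last exact: good11.
  have [n11|n11] := leqP n 11; first by apply: hit449; apply: (third 7 11).
  by apply: good13 => //; apply: (third 7 11).
have [d11|d11] := boolP (11 %| l); last by apply: good11 => //; lia.
have [d13|d13] := boolP (13 %| l); last by apply: good13 => //; lia.
(* Now 11 and 13 are the only prime divisors of [l], so its gcd with [88 = 8 * 11] is 11. *)
apply: (hit 89 11 15 11) => //; try by lia.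
- exact: (third 11 13 89).
- exact: (c2 3).
Qed.

(** * Upper bounds for products of primes *)

Lemma dvdn_logn (a b : nat) : 0 < a -> 0 < b ->
  (forall p, prime p -> logn p a <= logn p b) -> a %| b.
Proof.
move=> a0 b0 H; apply/dvdn_partP => // p; rewrite mem_primes => /and3P[p_pr _ _].
by rewrite p_part pfactor_dvdn // H.
Qed.

Lemma prod_primes_gt0 (n : nat) (P : pred nat) : 0 < \prod_(q < n | prime q && P q) q.
Proof. by apply: prodn_cond_gt0 => q /andP[/prime_gt0]. Qed.

Lemma logn_prod_primes (n : nat) (P : pred nat) p : prime p ->
  logn p (\prod_(q < n | prime q && P q) q) = (p < n) && P p.
Proof.
move=> p_pr; rewrite logn_prod_seq; last by move=> q /andP[/prime_gt0].
have [pn|pn] := ltnP p n => /=; last first.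
  rewrite big1 // => q /andP[q_pr _]; rewrite logn_prime //.
  by case: eqP => // pq; move: (ltn_ord q); rewrite -pq ltnNge pn.
have E (q : 'I_n) : prime q && P q -> q != Ordinal pn -> logn p q = 0.
  by move=> /andP[q_pr _] qp; rewrite logn_prime //; case: eqP => // pq; case/eqP: qp; apply: val_inj.
have [Pp|nPp] := boolP (P p).
  rewrite (bigD1 (Ordinal pn)) /= ?p_pr //= logn_prime // eqxx big1 ?addn0 // => q /andP[Pq /E->] //.
rewrite big1 // => q Pq; apply: (E) => //; apply/eqP => qp.
by move: Pq nPp; rewrite qp /= => /andP[_ ->].
Qed.

Lemma prod_primes_dvdn (n m : nat) (P : pred nat) : 0 < m ->
  (forall p, prime p -> p < n -> P p -> p %| m) ->
  \prod_(q < n | prime q && P q) q %| m.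
Proof.
move=> m0 H; apply: dvdn_logn (prod_primes_gt0 _ _) (m0) _ => p p_pr.
rewrite logn_prod_primes //; case: andP => [[pn Pp]|] //.
by rewrite logn_gt0 mem_primes p_pr m0 H.
Qed.

(** * Binomial coefficients and the primorial *)

Lemma bin_leq_exp2 (n k : nat) : 'C(n, k) <= 2 ^ n.
Proof.
elim: n k => [|n IH] [|k]; rewrite ?bin0 ?expn_gt0 //.
by rewrite binS expnS mul2n -addnn leq_add.
Qed.

(** The two equal middle coefficients together are at most the row sum [2 ^ m.*2.+1]. *)
Lemma bin_odd_leq (m : nat) : 'C(m.*2.+1, m) <= 4 ^ m.
Proof.
have E : 'C(m.*2.+1, m.+1) = 'C(m.*2.+1, m).
  by rewrite -bin_sub; [congr 'C(_, _); lia | lia].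
have : 'C(m.*2.+1, m) + 'C(m.*2.+1, m.+1) <= 2 ^ m.*2.+1.
  have -> : 2 ^ m.*2.+1 = \sum_(i < m.*2.+2) 'C(m.*2.+1, i).
    by rewrite -[in LHS](addn1 1) expnDn; apply: eq_bigr => i _; rewrite !exp1n !muln1.
  have m1 : m < m.*2.+2 by lia.
  have m2 : m.+1 < m.*2.+2 by lia.
  rewrite (bigD1 (Ordinal m1)) //= leq_add2l (bigD1 (Ordinal m2)) ?leq_addr //=.
  by apply/eqP => /(congr1 val) /=; lia.
by rewrite E addnn expnS mul2n leq_double -mul2n expnM.
Qed.

(** Erdos's induction: an even [n > 2] adds no prime, and for [n = 2m + 1] the primes in
    [(m + 1, n]] divide ['C(n, m)], which is at most [4 ^ m]. *)
Lemma primorial_leq (n : nat) : \prod_(p < n.+1 | prime p) p <= 4 ^ n.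
Proof.
elim/ltn_ind: n => n IH.
have [n2|n2] := leqP n 2.
  by case: n n2 {IH} => [|[|[|]]] // _; rewrite !big_mkcond !big_ord_recl big_ord0.
have [on|en] := boolP (odd n); last first.
  rewrite big_mkcond big_ord_recr /= -big_mkcond ifN ?muln1.
    case: n n2 IH {en} => // n n2 IH.
    by apply: leq_trans (IH n _) _ => //; rewrite leq_exp2l.
  by apply/negP => /prime_oddPn; rewrite en => /(_ isT); lia.
have [m En] : exists m, n = m.*2.+1 by exists n./2; lia.
have E : \prod_(p < n.+1 | prime p) p =
  (\prod_(p < m.+2 | prime p) p) * (\prod_(p < n.+1 | prime p && (m.+1 < p)) p).
  rewrite (bigID (fun p : 'I_n.+1 => p < m.+2)) /=; congr (_ * _).
    by rewrite -(big_ord_widen_cond n.+1 (fun p => prime p) id) //; lia.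
  by apply: eq_bigl => p; rewrite -leqNgt.
have B : \prod_(p < n.+1 | prime p && (m.+1 < p)) p <= 'C(n, m).
  apply: dvdn_leq; first by rewrite bin_gt0; lia.
  apply: (@prod_primes_dvdn n.+1 _ (fun p => m.+1 < p)); first by rewrite bin_gt0; lia.
  move=> p p_pr pn mp; have : p %| n`! by apply: dvdn_fact; rewrite prime_gt0.
  rewrite -(@bin_fact n m); last by lia.
  have nd k : k < p -> ~~ (p %| k`!).
    elim: k => [|k IHk] kp; first by rewrite fact0 dvdn1; case: eqP mp => [->|].
    by rewrite factS Euclid_dvdM // negb_or IHk 1?ltnW // andbT; apply/negP => /dvdn_leq; lia.
  rewrite Euclid_dvdM // => /orP[//|]; rewrite Euclid_dvdM //.
  by rewrite !(negPf (nd _ _)) //; lia.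
rewrite E; apply: leq_trans (leq_mul (IH m.+1 _) (leq_trans B _)) _; first by lia.
  by rewrite En; apply: bin_odd_leq.
by rewrite -expnD leq_exp2l //; lia.
Qed.

(** * Primes in an arithmetic progression *)

Lemma fact_dvdn_prod_consecutive (a K : nat) : K`! %| \prod_(i < K) (a.+1 + i).
Proof.
have -> : \prod_(i < K) (a.+1 + i) = (a + K) ^_ K.
  rewrite ffact_prod (reindex_inj rev_ord_inj) /=.
  by apply: eq_bigr => i _; have := ltn_ord i; lia.
by rewrite -bin_ffact dvdn_mull.
Qed.

(** Let [D] be the part of [K!] prime to [M], and [u] an inverse of [M] modulo [D]. Multiplying
    every term by [u] turns the progression into [K] consecutive integers modulo [D], whose product
    is divisible by [K!]. *)
Lemma fact_part_dvdn_prod_AP (M c k0 K : nat) : 0 < M -> 0 < c ->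
  (K`!)`_(\pi(M)^') %| \prod_(i < K) (c + M * (k0 + i)).
Proof.
move=> M0 c0; set D := _`_ _.
have coMD : coprime M D.
  by apply: (@pnat_coprime \pi(M)); [apply: pnat_pi | apply: part_pnat].
have D0 : 0 < D by apply: part_gt0.
have [u Eu] : exists u, M * u = 1 %[mod D].
  case: (egcdnP D M0) => u v E _; exists u.
  move: coMD; rewrite /coprime => /eqP g; rewrite g in E.
  by rewrite mulnC E -modnDml modnMl add0n.
have : D %| \prod_(i < K) (c + M * (k0 + i)) * u ^ K.
  rewrite -[K in u ^ K]card_ord -prod_nat_const -big_split /=.
  suff E : \prod_(i < K) ((c + M * (k0 + i)) * u) = \prod_(i < K) ((c * u + k0) + i) %[mod D].
    (* Adding [D] makes the starting point positive without changing any residue. *)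
    have [a Ea] : exists a, c * u + k0 + D = a.+1 by exists (c * u + k0 + D).-1; lia.
    have E2 : \prod_(i < K) ((c * u + k0) + i) = \prod_(i < K) (a.+1 + i) %[mod D].
      rewrite -Ea; elim/big_ind2: _ => // [x1 x2 y1 y2 H1 H2|i _].
        by rewrite -modnMm H1 H2 modnMm.
      by rewrite [in RHS]addnAC modnDr.
    rewrite /dvdn E E2; apply: dvdn_trans (fact_dvdn_prod_consecutive a K).
    exact: dvdn_part.
  elim/big_ind2: _ => // [x1 x2 y1 y2 H1 H2|i _].
    by rewrite -modnMm H1 H2 modnMm.
  rewrite mulnDl -addnA -[LHS]modnDmr -[RHS]modnDmr; congr ((_ + _) %% _).
  by rewrite mulnAC -modnMml Eu modnMml mul1n.
rewrite Gauss_dvdl // coprimeXr //.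
have : coprime D (M * u) by rewrite coprime_sym -coprime_modl Eu coprime_modl coprime1n.
by rewrite coprimeMr => /andP[].
Qed.

(** With [h = x %/ (2 * M)], all primes in question occur among the [K = h + 2] terms
    [c + M (h + i)]. Their product [G] exceeds no bound for [T / D], since [G] and the part [D] of
    [K!] prime to [M] are coprime and both divide the product [T] of these terms. Moreover [T] is at
    most [M ^ K] times [(h + K)! / h!], which is [K!] times a binomial coefficient of size at most
    [4 ^ K]. *)
Lemma prod_primes_AP_leq (M c x : nat) (P : pred nat) : 1 < M -> 0 < c < M -> 8 <= x ->
  (forall p, P p -> p %% M = c /\ x < 2 * p) ->
  \prod_(p < x.+1 | prime p && P p) p <=
    (4 * M) ^ (x %/ (2 * M) + 2) * ((x %/ (2 * M) + 2)`!)`_\pi(M).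
Proof.
move=> M1 /andP[c0 cM] x8 HP; set h := x %/ (2 * M); set K := h + 2.
set G := \prod_(p < _ | _) p; set T := \prod_(i < K) (c + M * (h + i)).
have hx : h * (2 * M) <= x by apply: leq_divM.
have xh : x < (h + 1) * (2 * M) by rewrite addn1 ltn_ceil //; lia.
have T0 : 0 < T by apply: prodn_gt0 => i; lia.
have K0 : 0 < K`! by apply: fact_gt0.
have GT : G %| T.
  apply: prod_primes_dvdn => // p p_pr px /HP[pc xp].
  have Ep := divn_eq p M; rewrite pc in Ep.
  have h1 : h <= p %/ M by nia.
  have h2 : p %/ M - h < K by nia.
  rewrite /T (bigD1 (Ordinal h2)) //= dvdn_mulr // subnKC // {1}Ep.
  by apply/eqP; rewrite addnC mulnC modnn.
have coGK : coprime G (K`!)`_(\pi(M)^').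
  rewrite /G; elim/big_ind: _ => [|a b ca cb|p /andP[p_pr /HP[_ xp]]].
  - exact: coprime1n.
  - by rewrite coprimeMl ca.
  rewrite prime_coprime //.
  apply: contra (_ : ~~ (p %| K`!)) => [/dvdn_trans->//|]; first exact: dvdn_part.
  have Kp : K < p by have : h * 4 <= h * (2 * M); [nia|rewrite /K; lia].
  elim: (K) Kp => [|k IH] kp; first by rewrite fact0 dvdn1; case: eqP p_pr => [->|].
  rewrite factS Euclid_dvdM // negb_or IH 1?ltnW // andbT.
  by apply/negP => /dvdn_leq-/(_ isT); rewrite leqNgt kp.
have GDT : G * (K`!)`_(\pi(M)^') <= T.
  apply: dvdn_leq => //; rewrite Gauss_dvd // GT fact_part_dvdn_prod_AP //; lia.
have TF : T * h`! <= M ^ K * (h + K)`!.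
  rewrite /T; elim: (K) => [|k IH]; first by rewrite big_ord0 expn0 addn0.
  rewrite big_ord_recr /= expnS addnS factS -addnS.
  rewrite (mulnAC _ (c + M * (h + k))).
  rewrite [M * M ^ k]mulnC [_ * (h + k)`!]mulnC mulnACA.
  by apply: leq_mul => //; rewrite addnS mulnS leq_add2r ltnW.
have BF : 'C(h + K, h) * h`! * K`! = (h + K)`!.
  by rewrite -(@bin_fact (h + K) h) ?leq_addr // addKn mulnA.
have B4 : 'C(h + K, h) <= 4 ^ K.
  by apply: leq_trans (bin_leq_exp2 _ _) _; rewrite -[4]/(2 ^ 2) -expnM leq_exp2l // /K; lia.
have KE : (K`!)`_\pi(M) * (K`!)`_(\pi(M)^') = K`! by apply: partnC.
have h0 : 0 < h`! by apply: fact_gt0.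
have D0 : 0 < (K`!)`_(\pi(M)^') by apply: part_gt0.
rewrite -(leq_pmul2r D0) -(leq_pmul2r h0) -[X in _ <= X * _]mulnA KE.
apply: leq_trans (_ : T * h`! <= _); first by rewrite leq_mul2r GDT orbT.
apply: leq_trans TF _; rewrite -BF expnMn.
rewrite [X in X <= _](_ : _ = 'C(h + K, h) * (M ^ K * h`! * K`!)); last by rewrite -!mulnA mulnCA.
rewrite [X in _ <= X](_ : _ = 4 ^ K * (M ^ K * h`! * K`!)); last by rewrite -!mulnA [K`! * _]mulnC.
by rewrite leq_mul2r B4 orbT.
Qed.

Lemma logn_fact_leq (p n : nat) : prime p -> p.-1 * logn p n`! <= n.
Proof.
move=> p_pr; rewrite logn_fact // big_distrr /=.
have p1 := prime_gt1 p_pr.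
(* The extra term [n %/ p ^ J] makes Legendre's sum telescope. *)
suff H J : \sum_(1 <= k < J.+1) p.-1 * (n %/ p ^ k) + n %/ p ^ J <= n.
  by apply: leq_trans (H n); apply: leq_addr.
elim: J => [|J IH]; first by rewrite big_geq // expn0 divn1.
rewrite big_nat_recr //= -addnA.
set a := n %/ p ^ J.+1.
have -> : p.-1 * a + a = a * p by rewrite -[in RHS](prednK (prime_gt0 p_pr)) mulnS addnC mulnC.
apply: leq_trans IH; rewrite leq_add2l /a expnSr divnMA.
exact: leq_divM.
Qed.

(** Only the primes 2, 3 and [q] contribute. By the bound [K / (p - 1)] on valuations, the fourth
    powers of their contributions are at most [16 ^ K], [9 ^ K] and [5 ^ K], and
    [720 = 16 * 9 * 5]. *)
Lemma fact_part_leq (q K : nat) : prime q -> 5 <= q ->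
  ((K`!)`_\pi(6 * q)) ^ 4 <= 720 ^ K.
Proof.
move=> q_pr q5.
have E : (K`!)`_\pi(6 * q) <= 2 ^ logn 2 K`! * 3 ^ logn 3 K`! * q ^ logn q K`!.
  apply: dvdn_leq; first by rewrite !muln_gt0 !expn_gt0 !(prime_gt0 q_pr).
  apply/dvdn_partP => // p pK; have ppi := pnatPpi (part_pnat _ _) pK.
  rewrite partn_part => [|r]; last by rewrite inE => /eqP->.
  have /or3P[] : [|| p == 2, p == 3 | p == q].
    move: ppi; rewrite mem_primes => /and3P[p_pr _].
    by rewrite -[6]/(2 * 3) !Euclid_dvdM // !dvdn_prime2 // -orbA.
  - by move/eqP->; rewrite p_part -mulnA dvdn_mulr.
  - by move/eqP->; rewrite p_part mulnAC dvdn_mull.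
  - by move/eqP->; rewrite p_part dvdn_mull.
apply: leq_trans (_ : (2 ^ logn 2 K`! * 3 ^ logn 3 K`! * q ^ logn q K`!) ^ 4 <= _).
  by rewrite leq_exp2r.
rewrite !expnMn -!expnM.
have E2 : 2 ^ (logn 2 K`! * 4) <= 16 ^ K.
  by rewrite -[16]/(2 ^ 4) -expnM leq_exp2l //; have := @logn_fact_leq 2 K isT; lia.
have E3 : 3 ^ (logn 3 K`! * 4) <= 9 ^ K.
  by rewrite -[9]/(3 ^ 2) -expnM leq_exp2l //; have := @logn_fact_leq 3 K isT; lia.
(* Equality holds at [q = 5]; afterwards one step multiplies the left side by at most 4. *)
have q4 : q ^ 4 <= 5 ^ q.-1.
  have -> : q = (q - 5) + 5 by lia.
  rewrite addnS /=; elim: (q - 5) => // r IH; rewrite [in X in _ <= X]addSn [X in _ <= X]expnS.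
  have H : (r.+1 + 4).+1 ^ 2 <= 2 * (r + 4).+1 ^ 2 by rewrite -!mulnn; nia.
  apply: leq_trans _ (leq_mul (leqnn 5) IH).
  have E4 z : z ^ 4 = (z ^ 2) ^ 2 by rewrite -expnM.
  rewrite !E4; apply: (@leq_trans ((2 * (r + 4).+1 ^ 2) ^ 2)); first by rewrite leq_sqr.
  by rewrite expnMn leq_mul2r orbT.
have Eq : q ^ (logn q K`! * 4) <= 5 ^ K.
  rewrite mulnC expnM; apply: (@leq_trans ((5 ^ q.-1) ^ logn q K`!)).
    by case: logn => // v; rewrite leq_exp2r.
  by rewrite -expnM leq_exp2l // logn_fact_leq.
rewrite (_ : 720 = 16 * 9 * 5) // !expnMn.
by rewrite !leq_mul.
Qed.

(** By the Chinese remainder theorem the two congruences define at most one class modulo [6 * q],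
    represented by any such prime [p0]. The fourth power keeps the bound of [fact_part_leq]
    integral. *)
Lemma prod_primes_1mod_leq (q c x : nat) : prime q -> 5 <= q -> 8 <= x ->
  (\prod_(p < x.+1 | prime p && [&& x < 2 * p, p %% q == 1 & p %% 6 == c]) p) ^ 4
    <= ((24 * q) ^ 4 * 720) ^ (x %/ (12 * q) + 2).
Proof.
move=> q_pr q5 x8; set P := fun p => [&& x < 2 * p, p %% q == 1 & p %% 6 == c].
case: (pickP (fun p : 'I_x.+1 => P p)) => [p0 /and3P[_ /eqP p0q /eqP p0c]|noP]; last first.
  rewrite big1 ?exp1n ?expn_gt0 ?muln_gt0 ?expn_gt0 ?(prime_gt0 q_pr) //.
  by move=> p; rewrite -/(P p) [P p]noP andbF.
have co : coprime 6 q.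
  rewrite -[6]/(2 * 3) coprimeMl !prime_coprime // !dvdn_prime2 //.
  by apply/andP; split; apply/eqP => E; rewrite -E in q5.
have HP p : P p -> p %% (6 * q) = p0 %% (6 * q) /\ x < 2 * p.
  case/and3P => xp /eqP pq /eqP pc; split => //.
  by apply/eqP; rewrite chinese_remainder // pq pc p0q p0c !eqxx.
have c0 : 0 < p0 %% (6 * q) < 6 * q.
  rewrite ltn_pmod ?muln_gt0 ?(prime_gt0 q_pr) // andbT lt0n; apply/negP => /eqP E.
  have : q %| p0 by apply: dvdn_trans (_ : 6 * q %| _); rewrite ?dvdn_mull // /dvdn E.
  by rewrite /dvdn p0q.
have M1 : 1 < 6 * q by lia.
have := prod_primes_AP_leq M1 c0 x8 HP.
rewrite -(leq_exp2r _ _ (isT : 0 < 4)) => /leq_trans; apply.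
have E1 : 4 * (6 * q) = 24 * q by rewrite mulnA.
have E2 : 2 * (6 * q) = 12 * q by rewrite mulnA.
rewrite E1 E2; move: (_ + 2) => K.
rewrite [X in X <= _]expnMn [X in _ <= X]expnMn -[X in X * _ <= _]expnM [K * 4]mulnC expnM.
by apply: leq_mul (leqnn _) (fact_part_leq K q_pr q5).
Qed.

(** * Lower bounds for products of primes *)

Definition class_prod (c y : nat) : nat := \prod_(1 <= n < y.+1 | n %% 3 == c) n.

(** For [c] equal to 1 or 2, the number of positive integers up to [y] that are [c] modulo 3. *)
Definition class_count (c y : nat) : nat := (y + (3 - c)) %/ 3.

Lemma class_prod_gt0 c y : 0 < class_prod c y.
Proof.
rewrite /class_prod big_nat_cond; apply: prodn_cond_gt0 => n.
by case/andP => /andP[].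
Qed.

(** As [d] is its own inverse modulo 3, a multiple [m d] is [c] modulo 3 iff [m] is [c d] modulo
    3. *)
Lemma sum_dvdn_class (c d y : nat) : 0 < c < 3 -> d %% 3 != 0 ->
  \sum_(1 <= n < y.+1 | n %% 3 == c) (d %| n) = class_count ((c * d) %% 3) (y %/ d).
Proof.
move=> c3 d3; have d0 : 0 < d by case: d d3.
have cd3 : 0 < (c * d) %% 3 < 3.
  rewrite -modnMmr; move: d3 (ltn_pmod d (isT : 0 < 3)).
  by case: (d %% 3) => [|[|[|]]] // _ _; lia.
elim: y => [|y IH].
  by rewrite big_geq // div0n /class_count; move: (_ %% 3) cd3 => r; lia.
rewrite big_mkcond big_nat_recr //= -big_mkcond /= IH [in RHS]divnS // addnC.
have [/dvdnP[k Ek]|_] := boolP (d %| y.+1); last by rewrite if_same.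
have k0 : 0 < k by case: k Ek.
have -> : y %/ d = k.-1.
  have -> : y = k.-1 * d + d.-1 by move: Ek; rewrite -{1}(prednK k0) mulSn; move: (_ * _) => z; lia.
  by rewrite divnMDl // divn_small ?addn0 // prednK.
rewrite Ek -(prednK k0) /= add1n /class_count -(modnMmr _ d) -(modnMmr c d).
move: d3 (ltn_pmod d (isT : 0 < 3)) {IH cd3 Ek k0}.
case: (d %% 3) => [|[|[|]]] // _ _; move: k.-1 => {}k; case: c c3 => [|[|[|]]] // _.
all: by case: eqP => H; lia.
Qed.

(** Legendre's formula for one residue class; [J] is any cut-off beyond which no power of [p]
    contributes. *)
Lemma logn_class_prod (p c y J : nat) : prime p -> p != 3 -> 0 < c < 3 -> y <= J ->
  logn p (class_prod c y) =
  \sum_(1 <= j < J.+1) class_count ((c * (p ^ j %% 3)) %% 3) (y %/ p ^ j).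
Proof.
move=> p_pr p3 c3 yJ.
have pj3 j : p ^ j %% 3 != 0.
  apply: contra p3 => /eqP E; have : 3 %| p ^ j by rewrite /dvdn E.
  by rewrite Euclid_dvdX // dvdn_prime2 // => /andP[/eqP<-].
rewrite /class_prod logn_prod_seq; last by move=> n /eqP; case: n => // E; rewrite -E in c3.
under [RHS]eq_bigr => j _.
  rewrite -(modnMmr c) modn_mod modnMmr -sum_dvdn_class //; over.
rewrite exchange_big /= big_nat_cond [RHS]big_nat_cond; apply: eq_bigr => n /andP[/andP[n0 ny] _].
have nJ : n <= J.+1 by apply: leq_trans (ltnW ny) _; rewrite ltnS.
rewrite logn_count_dvd // [RHS](big_cat_nat _ (n := n)) //=.
rewrite [X in _ = _ + X]big1_seq ?addn0 // => j /andP[_]; rewrite mem_index_iota => /andP[nj _].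
apply/eqP; rewrite eqb0; apply/negP => /dvdn_leq-/(_ n0); rewrite leqNgt.
by rewrite (leq_ltn_trans nj) // ltn_expl // prime_gt1.
Qed.

(** A list of pairs [(c, k)] encodes the product of the [P_c(x/k)]; a prime power
    [p^j] divides [list_count L (p^j mod 3) (x / p^j)] of its factors, because
    [m p^j = c] modulo 3 iff [m = c p^j]. *)
Definition list_prod (L : seq (nat * nat)) (x : nat) : nat :=
  \prod_(u <- L) class_prod u.1 (x %/ u.2).

Definition list_count (L : seq (nat * nat)) (c y : nat) : nat :=
  sumn [seq class_count ((u.1 * c) %% 3) (y %/ u.2) | u <- L].

Definition class_list (L : seq (nat * nat)) : bool := all (fun u => (0 < u.1 < 3) && (0 < u.2)) L.

Lemma list_prod_gt0 L x : 0 < list_prod L x.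
Proof. by apply: prodn_gt0 => u; apply: class_prod_gt0. Qed.

Lemma logn_list_prod (p x : nat) L : prime p -> p != 3 -> class_list L ->
  logn p (list_prod L x) = \sum_(1 <= j < x.+1) list_count L (p ^ j %% 3) (x %/ p ^ j).
Proof.
move=> p_pr p3 /allP HL.
rewrite /list_prod logn_prod_seq => [|u _]; last exact: class_prod_gt0.
under [RHS]eq_bigr do rewrite /list_count sumnE big_map.
rewrite exchange_big /= big_seq [RHS]big_seq; apply: eq_bigr => u /HL /andP[u1 u2].
rewrite (@logn_class_prod _ _ _ x) ?leq_div //.
by apply: eq_bigr => j _; rewrite -!divnMA [_ * u.2]mulnC.
Qed.

Lemma logn3_list_prod x L : class_list L -> logn 3 (list_prod L x) = 0.
Proof.
move=> /allP HL; rewrite /list_prod logn_prod_seq => [|u _]; last exact: class_prod_gt0.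
rewrite big1_seq // => u /= /HL /andP[u1 _]; rewrite /class_prod logn_prod_seq => [|n /eqP E].
  rewrite big1 // => n /eqP E; apply/eqP; rewrite eqn0Ngt logn_gt0 mem_primes /= negb_and.
  by apply/orP; right; rewrite /dvdn E; case: (u.1) u1.
by case: n E u1 => // <-.
Qed.

(** * Comparing two products by a finite certificate *)

Lemma sum_leq_bool (n T : nat) : \sum_(2 <= j < n) (j <= T) <= T.
Proof.
suff : \sum_(2 <= j < n) (j <= T) <= minn n.-1 T by rewrite leq_min => /andP[].
elim: n => [|n IH]; first by rewrite big_geq.
have [n1|n1] := leqP n 1; first by rewrite big_geq.
by rewrite big_nat_recr //=; lia.
Qed.

(** Valuations are compared prime by prime. The excess at [j = 1] is absorbed by the primes of
    [(x/2, x]] selected by [w] and by the primorials of [x %/ Y1] and [x %/ Y2]. For [j >= 2] only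
    primes up to [s] matter; they are absorbed by [B], which is at most [x ^ (2 * s)]. *)
Lemma certificate_bound (N D : seq (nat * nat)) (w : pred nat) (Y1 Y2 x s : nat) :
  class_list N -> class_list D -> 1 < Y1 -> 1 < Y2 -> 0 < x -> x < s.+1 ^ 2 ->
  (forall c y, 0 < c < 3 -> list_count N c y <=
     list_count D c y + (w c && (y == 1)) + (Y1 <= y) + (Y2 <= y)) ->
  list_prod N x <= list_prod D x *
    \prod_(p < x.+1 | prime p && ((x < 2 * p) && w (p %% 3))) p *
    (4 ^ (x %/ Y1) * 4 ^ (x %/ Y2)) * x ^ (2 * s).
Proof.
move=> HN HD Y1_gt1 Y2_gt1 x0 xs H.
have [Y1_gt0 Y2_gt0] := (ltnW Y1_gt1, ltnW Y2_gt1).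
set G := \prod_(p < x.+1 | _) p.
pose A Y := \prod_(p < (x %/ Y).+1 | prime p && true) p.
pose B := \prod_(p < s.+1 | prime p) p ^ (2 * trunc_log p x).
have G0 : 0 < G by apply: (@prod_primes_gt0 x.+1 (fun p => (x < 2 * p) && w (p %% 3))).
have A0 Y : 0 < A Y by apply: (@prod_primes_gt0 _ xpredT).
have B0 : 0 < B by apply: prodn_cond_gt0 => p p_pr; rewrite expn_gt0 prime_gt0.
have A4 Y : A Y <= 4 ^ (x %/ Y).
  by apply: leq_trans _ (primorial_leq _); rewrite /A; under eq_bigl do rewrite andbT.
have Bx : B <= x ^ (2 * s).
  apply: (@leq_trans (\prod_(p < s.+1 | prime p) x ^ 2)).
    apply: leq_prod => p p_pr; rewrite mulnC expnM leq_exp2r //.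
    by apply: trunc_logP; rewrite ?prime_gt1.
  rewrite big_mkcond big_ord_recl /= mul1n -[s in X in _ <= X]card_ord expnM -prod_nat_const.
  by apply: leq_prod => i _; case: ifP => // _; rewrite expn_gt0 x0.
suff : list_prod N x <= list_prod D x * G * (A Y1 * A Y2) * B.
  by move/leq_trans; apply; rewrite !leq_mul.
apply: dvdn_leq; first by rewrite !muln_gt0 list_prod_gt0 G0 !A0.
apply: dvdn_logn => [||p p_pr]; rewrite ?list_prod_gt0 ?muln_gt0 ?G0 ?A0 ?list_prod_gt0 //.
have [->|p3] := eqVneq p 3; first by rewrite logn3_list_prod.
rewrite !lognM ?muln_gt0 ?G0 ?A0 ?list_prod_gt0 // !logn_list_prod //.
have LG := @logn_prod_primes x.+1 (fun p => (x < 2 * p) && w (p %% 3)) p p_pr.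
have LA Y := @logn_prod_primes (x %/ Y).+1 xpredT p p_pr.
rewrite [logn p G]LG ![logn p (A _)]LA.
have p1 := prime_gt1 p_pr.
have pj3 j : 0 < p ^ j %% 3 < 3.
  rewrite ltn_mod andbT lt0n; apply: contra p3 => /eqP E.
  have : 3 %| p ^ j by rewrite /dvdn E.
  by rewrite Euclid_dvdX // dvdn_prime2 // eq_sym => /andP[].
pose e j := (w (p ^ j %% 3) && (x %/ p ^ j == 1)) + (Y1 <= x %/ p ^ j) + (Y2 <= x %/ p ^ j).
apply: (@leq_trans (\sum_(1 <= j < x.+1) (list_count D (p ^ j %% 3) (x %/ p ^ j) + e j))).
  by apply: leq_sum => j _; rewrite !addnA H.
rewrite big_split /= -!addnA leq_add2l big_ltn // !addnA.
have E1 : e 1 <= ((p < x.+1) && ((x < 2 * p) && w (p %% 3))) +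
    (p < (x %/ Y1).+1) && true + (p < (x %/ Y2).+1) && true.
  rewrite /e !andbT expn1 !ltnS !(leq_divRL _ _ (prime_gt0 p_pr)).
  rewrite (leq_divRL _ _ Y1_gt0) (leq_divRL _ _ Y2_gt0) !(mulnC p) !leq_add2r.
  case: (w _) => //=; rewrite andbT; case: eqP => // E.
  by have := divn_eq x p; have := ltn_pmod x (ltnW p1); rewrite E; lia.
apply: leq_add => //.
have [ps|ps] := ltnP p s.+1.
  apply: (@leq_trans (2 * trunc_log p x)); last first.
    rewrite -[X in X <= _](pfactorK _ p_pr); apply: dvdn_leq_log => //.
    by rewrite /B (bigD1 (Ordinal ps)) //= dvdn_mulr.
  apply: (@leq_trans (\sum_(2 <= j < x.+1) 2 * (j <= trunc_log p x))).
    rewrite big_nat_cond [X in _ <= X]big_nat_cond; apply: leq_sum => j _.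
    have [jx|jx] := leqP (p ^ j) x.
      rewrite (trunc_log_max p1 jx) /e muln1.
      (* Here [e j <= 2], because quotient 1 lies below both thresholds [Y1] and [Y2]. *)
      have [y1|y1] := leqP (x %/ p ^ j) 1.
        rewrite !(leqNgt _ (x %/ _)) !(leq_ltn_trans y1) //= andbC.
        by case: (w _) => //; rewrite ?addn0; case: (_ == 1).
      by rewrite [_ == 1]gtn_eqF // andbF; case: (Y1 <= _); case: (Y2 <= _).
    by rewrite /e divn_small // andbF !leqn0 !gtn_eqF.
  by rewrite -big_distrr /= leq_mul2l /= sum_leq_bool.
rewrite big1_seq // => j /andP[_]; rewrite mem_index_iota => /andP[j2 _].
have pjx : x < p ^ j.
  apply: (leq_trans xs); apply: (@leq_trans (p ^ 2)); first by rewrite leq_sqr.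
  by rewrite leq_exp2l.
by rewrite /e divn_small // andbF !leqn0 !gtn_eqF.
Qed.

Lemma of_nat_divmod a b : 0 < b ->
  N.of_nat (a %/ b) = N.div (N.of_nat a) (N.of_nat b) /\
  N.of_nat (a %% b) = N.modulo (N.of_nat a) (N.of_nat b).
Proof.
move=> b0; have lt : (N.of_nat (a %% b) < N.of_nat b)%num by have := ltn_pmod a b0; lia.
have E : N.of_nat a = (N.of_nat b * N.of_nat (a %/ b) + N.of_nat (a %% b))%num.
  by rewrite [in LHS](divn_eq a b) mulnC; lia.
by split; [apply: N.div_unique lt E | apply: N.mod_unique lt E].
Qed.

Definition list_countN (L : seq (N * N)) (c y : N) : N :=
  foldr (fun u s => (((y / u.2) + (3 - (u.1 * c) mod 3)) / 3 + s)%num) 0%num L.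

Definition of_nat2 (u : nat * nat) : N * N := (N.of_nat u.1, N.of_nat u.2).

Lemma list_countNE L c y : class_list L ->
  list_countN (map of_nat2 L) (N.of_nat c) (N.of_nat y) = N.of_nat (list_count L c y).
Proof.
elim: L => //= -[c' k] L IH /= /andP[/andP[_ k0] HL].
rewrite IH // -(of_nat_divmod y k0).1 /list_count /= /class_count.
have -> : N.mul (N.of_nat c') (N.of_nat c) = N.of_nat (c' * c) by lia.
rewrite -(of_nat_divmod (c' * c) (isT : 0 < 3)).2.
move: (y %/ k) ((c' * c) %% 3) (sumn _) => z v S.
have -> : (N.of_nat z + (3 - N.of_nat v))%num = N.of_nat (z + (3 - v)) by lia.
by rewrite -(of_nat_divmod _ (isT : 0 < 3)).1; lia.
Qed.

(** The hypothesis of [certificate_bound] is periodic in [y] up to a common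
    increment [slope], so that finitely many [y] suffice. *)
Definition certificate (N D : seq (nat * nat)) (w : pred nat) (Y1 Y2 t : nat) : bool :=
  let N' := map of_nat2 N in
  let D' := map of_nat2 D in
  let ok c y := N.leb (list_countN N' (N.of_nat c) (N.of_nat y))
    (list_countN D' (N.of_nat c) (N.of_nat y) +
       N.of_nat ((w c && (y == 1)) + (Y1 <= y) + (Y2 <= y))) in
  let slope L := sumn [seq t %/ u.2 | u <- L] in
  [&& class_list N, class_list D, all (fun u => u.2 %| t) (N ++ D),
      slope N == slope D, 1 < Y1 <= 3 * t, 1 < Y2 <= 3 * t &
      all (fun y => ok 1 y && ok 2 y) (iota 0 (3 * t))].

Lemma list_count_periodic L c t y : class_list L -> all (fun u => u.2 %| t) L ->
  list_count L c (y + 3 * t) = list_count L c y + sumn [seq t %/ u.2 | u <- L].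
Proof.
rewrite /list_count; elim: L => //= -[c' k] L IH /= /andP[/andP[_ k0] HL] /andP[/dvdnP[r Er] kL].
rewrite IH // addnACA; congr (_ + _).
rewrite Er mulnK // mulnA addnC divnMDl // /class_count; move: (y %/ k) => z; lia.
Qed.

Lemma certificateP N D w Y1 Y2 t : certificate N D w Y1 Y2 t ->
  [/\ class_list N, class_list D, 1 < Y1, 1 < Y2 &
   forall c y, 0 < c < 3 -> list_count N c y <=
     list_count D c y + (w c && (y == 1)) + (Y1 <= y) + (Y2 <= y)].
Proof.
case/and4P => HN HD; rewrite all_cat => /andP[tN tD].
case/and4P => /eqP sND /andP[Y1_gt1 Y1t] /andP[Y2_gt1 Y2t] /allP H.
split=> // c y c3; elim/ltn_ind: y => y IH.
have [yt|yt] := ltnP y (3 * t).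
  have /H/andP[] : y \in iota 0 (3 * t) by rewrite mem_iota.
  by rewrite !list_countNE //; case: c c3 {IH} => [|[|[|]]] // _; lia.
have Ey : y = (y - 3 * t) + 3 * t by lia.
have lt : y - 3 * t < y by lia.
have := IH _ lt; rewrite Ey !list_count_periodic // addnK sND.
have -> : (Y1 <= y - 3 * t + 3 * t) by lia.
have -> : (Y2 <= y - 3 * t + 3 * t) by lia.
(* If [y - 3 * t = 1], the indicator lost in passing to [y] is made up for by [Y1 <= y], which fails
   at 1. *)
by have [y1|_] := eqVneq (y - 3 * t) 1; rewrite ?y1 ?andbF; lia.
Qed.

(** The two certificates were found by linear programming.  Up to tails, the
    first one yields [0.18 x] for the primes [2 mod 3], where [0.25 x] is the truth,
    and the second one [0.42 x] for all primes, where [0.5 x] is the truth. *)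
Definition numA := [:: (2, 1); (1, 4); (1, 10); (2, 10); (1, 24); (2, 24); (1, 60); (2, 60)].
Definition denA := [:: (1, 2); (2, 2); (1, 5); (2, 5); (1, 12); (2, 12)].

(** For each [k] this encodes the product of all integers up to [x %/ k] that are prime to 3. *)
Definition both_classes (ks : seq nat) := flatten [seq [:: (1, k); (2, k)] | k <- ks].
Definition numB := both_classes [:: 1; 4; 10; 24; 36; 90; 120; 180].
Definition denB := both_classes [:: 2; 2; 5; 6; 18; 45].

Lemma certificateA : certificate numA denA (pred1 2) 49 121 120.
Proof. by vm_cast_no_check (erefl true). Qed.

Lemma certificateB : certificate numB denB xpredT 121 181 360.
Proof. by vm_cast_no_check (erefl true). Qed.

(** * Upper bounds in the absence of a suitable prime *)

Definition prime_prod (n : nat) (P : pred nat) : nat := \prod_(p < n | prime p && P p) p.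

Lemma prime_prod_gt0 n P : 0 < prime_prod n P.
Proof. exact: prod_primes_gt0. Qed.

Lemma prime_prodU n (P P1 P2 : pred nat) :
  (forall p, prime p -> p < n -> P p -> P1 p || P2 p) ->
  prime_prod n P <= prime_prod n P1 * prime_prod n P2.
Proof.
move=> H; have gt0 : 0 < prime_prod n P1 * prime_prod n P2 by rewrite muln_gt0 !prime_prod_gt0.
apply: dvdn_leq => //; apply: dvdn_logn => [|//|p p_pr]; first exact: prime_prod_gt0.
rewrite lognM ?prime_prod_gt0 // !logn_prod_primes //.
by have := H p p_pr; case: (p < n) (P p) (P1 p) (P2 p) => [] [] [] [] // /(_ isT isT).
Qed.

(** A window of [b] integers contains at most [b] primes, each at most [x]. *)
Lemma prime_prod_window x a b (P : pred nat) : 0 < x ->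
  (forall p, prime p -> P p -> a < p <= a + b) -> prime_prod x.+1 P <= x ^ b.
Proof.
move=> x0 H; apply: (@leq_trans (\prod_(0 <= p < x.+1) if a < p <= a + b then x else 1)).
  rewrite /prime_prod big_mkcond big_mkord; apply: leq_prod => p _.
  case: ifP => [/andP[p_pr Pp]|_]; first by rewrite H // -ltnS.
  by case: ifP.
suff H1 n : \prod_(0 <= p < n) (if a < p <= a + b then x else 1) <= x ^ (minn b (n.-1 - a)).
  by apply: leq_trans (H1 _) _; apply: leq_pexp2l => //; apply: geq_minl.
elim: n => [|n IH]; first by rewrite big_geq // expn_gt0 x0.
rewrite big_nat_recr //=; case: ifP => nab; last first.
  by rewrite muln1; apply: leq_trans IH _; apply: leq_pexp2l => //; lia.
apply: leq_trans (leq_mul IH (leqnn x)) _; rewrite -expnSr; apply: leq_pexp2l => //; lia.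
Qed.

Definition bad_class (x q c : nat) : nat :=
  prime_prod x.+1 (fun p => [&& x < 2 * p, p %% q == 1 & p %% 6 == c]).

Lemma prime_mod6 p : prime p -> 3 < p -> (p %% 6 == 1) || (p %% 6 == 5).
Proof.
move=> p_pr p3; have n2 : ~~ (2 %| p) by rewrite dvdn_prime2 //; apply/eqP; lia.
have n3 : ~~ (3 %| p) by rewrite dvdn_prime2 //; apply/eqP; lia.
by move: n2 n3; rewrite /dvdn; lia.
Qed.

Lemma dvdn_pred_mod p s : prime p -> prime s -> s %| p * p.-1 -> (p == s) || (p %% s == 1).
Proof.
move=> p_pr s_pr; rewrite Euclid_dvdM // dvdn_prime2 // eq_sym => /orP[->//|/dvdnP[k Ek]].
apply/orP; right; rewrite -(prednK (prime_gt0 p_pr)) Ek -addn1 modnMDl modn_small //.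
exact: prime_gt1.
Qed.

Section NoGoodPrime.
Variables (l N x : nat).
Hypotheses (l0 : 0 < l) (x8 : 8 <= x) (xN : x <= N) (Nx : N < x + 1080).
Hypothesis noprime : forall p, prime p -> p <= N -> N < 2 * p -> ~~ coprime l (p * p.-1).

Let x0 : 0 < x. Proof. by lia. Qed.

(** A prime of [(x/2, x]] either is at most [N/2], and so lies in a short window, or is spoiled by a
    prime [s] dividing [l]. *)
Let bad p : prime p -> p < x.+1 -> x < 2 * p ->
  (x < 2 * p <= N) || [exists s : 'I_p.+1, [&& prime s, s %| l & (p == s) || (p %% s == 1)]].
Proof.
move=> p_pr px xp; have [pN|pN] := leqP (2 * p) N; first by rewrite xp.
apply/orP; right.
have pleN : p <= N by lia.
have [s [s_pr sl sp]] := noncoprime_prime l0 (noprime p_pr pleN pN).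
have := dvdn_pred_mod p_pr s_pr sp => ps.
have sp' : s < p.+1.
  move: sp; rewrite Euclid_dvdM // => /orP[] /dvdn_leq; first by rewrite prime_gt0 // => /(_ isT).
  by have := prime_gt1 p_pr; case: (p) => [|[]] //= k _ /(_ isT); lia.
by apply/existsP; exists (Ordinal sp'); rewrite /= s_pr sl ps.
Qed.

Let window : prime_prod x.+1 (fun p => x < 2 * p <= N) <= x ^ 540.
Proof. by apply: (@prime_prod_window x (x %/ 2)) => // p _; lia. Qed.

Let single s : prime_prod x.+1 (pred1 s) <= x.
Proof.
rewrite -[X in _ <= X]expn1; apply: (@prime_prod_window x s.-1) => // p p_pr /eqP <-.
by move: (prime_gt0 p_pr); lia.
Qed.

(** A prime that is 2 modulo 3 cannot be spoiled by [s = 3], so only [r] matters. The exponent is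
    540 for the window plus 1 for [p = r]; the remaining primes are 5 modulo 6. *)
Lemma prime_prod_le_A r : prime r -> 5 <= r ->
  (forall s, prime s -> s %| l -> (s == 3) || (s == r)) ->
  prime_prod x.+1 (fun p => (x < 2 * p) && (p %% 3 == 2)) <= x ^ 541 * bad_class x r 5.
Proof.
move=> r_pr r5 lr.
apply: leq_trans (prime_prodU (P1 := fun p => x < 2 * p <= N)
  (P2 := fun p => [&& x < 2 * p, p %% 3 == 2 & (p == r) || (p %% r == 1)]) _) _.
  move=> p p_pr px /andP[xp p2]; have /orP[->//|/existsP[s /and3P[s_pr sl ps]]] := bad p_pr px xp.
  apply/orP; right; rewrite xp p2 /=.
  by have /orP[] := lr s s_pr sl => /eqP E; move: ps p2; rewrite E // => /orP[]/eqP->.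
rewrite (expnD x 540 1) expn1 -mulnA leq_mul //.
apply: leq_trans (prime_prodU (P1 := pred1 r) (P2 :=
  (fun p => [&& x < 2 * p, p %% r == 1 & p %% 6 == 5])) _) _; last by rewrite leq_mul.
move=> p p_pr px /and3P[xp p2 /=]; case: eqP => //= _ pr; rewrite xp pr /=.
have p3 : 3 < p by lia.
by have := prime_mod6 p_pr p3; lia.
Qed.

(** The exponent is 540 for the window plus 2 for [p = q] and [p = r]; the remaining primes split
    into the classes 1 and 5 modulo 6. *)
Lemma prime_prod_le_B q r : prime q -> prime r -> 5 <= q -> 5 <= r ->
  (forall s, prime s -> s %| l -> (s == q) || (s == r)) ->
  prime_prod x.+1 (fun p => (x < 2 * p) && xpredT (p %% 3)) <=
    x ^ 542 * (bad_class x q 1 * bad_class x q 5 * (bad_class x r 1 * bad_class x r 5)).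
Proof.
move=> q_pr r_pr q5 r5 lqr.
have split s : prime_prod x.+1 (fun p => (x < 2 * p) && ((p == s) || (p %% s == 1))) <=
    x * (bad_class x s 1 * bad_class x s 5).
  apply: leq_trans (prime_prodU (P1 := pred1 s)
    (P2 := fun p => (x < 2 * p) && (p %% s == 1)) _) _.
    by move=> p _ _ /andP[-> /orP[]/= ->]; rewrite ?orbT.
  rewrite leq_mul //; apply: prime_prodU => p p_pr px /andP[xp ps].
  have p3 : 3 < p by lia.
  by rewrite xp ps; apply: prime_mod6.
apply: leq_trans (prime_prodU (P1 := fun p => x < 2 * p <= N)
  (P2 := fun p => (x < 2 * p) &&
     (((p == q) || (p %% q == 1)) || ((p == r) || (p %% r == 1)))) _) _.
  move=> p p_pr px /andP[xp _]; have /orP[->//|/existsP[s /and3P[s_pr sl ps]]] := bad p_pr px xp.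
  apply/orP; right; rewrite xp /=.
  by have /orP[] := lqr s s_pr sl => /eqP E; move: ps; rewrite E => ->; rewrite ?orbT.
rewrite (expnD x 540 2) -mulnA leq_mul //.
apply: leq_trans (prime_prodU (P1 := fun p => (x < 2 * p) && ((p == q) || (p %% q == 1)))
  (P2 := fun p => (x < 2 * p) && ((p == r) || (p %% r == 1))) _) _.
  by move=> p _ _ /andP[->].
apply: leq_trans (leq_mul (split q) (split r)) _.
by rewrite mulnACA mulnn.
Qed.

End NoGoodPrime.

Lemma bad_class_leq x q c : prime q -> 5 <= q -> 8 <= x ->
  bad_class x q c ^ 4 <= ((24 * q) ^ 4 * 720) ^ (x %/ (12 * q) + 2).
Proof. exact: prod_primes_1mod_leq. Qed.

Lemma bad_class_large x q c : prime q -> x < q -> bad_class x q c = 1.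
Proof.
move=> q_pr xq; rewrite /bad_class /prime_prod big1 // => p /andP[p_pr /and3P[_ pq _]].
have pq' : p < q by apply: leq_ltn_trans xq; rewrite -ltnS.
by move: pq; rewrite modn_small // => /eqP.
Qed.

Lemma odd_primes_cover l : odd l -> size (primes l) <= 2 ->
  (exists r, [/\ prime r, 5 <= r & forall s, prime s -> s %| l -> (s == 3) || (s == r)]) \/
  (exists q r, [/\ prime q, prime r, 5 <= q, 7 <= r &
     forall s, prime s -> s %| l -> (s == q) || (s == r)]).
Proof.
move=> l_odd sz; have l0 : 0 < l by case: l l_odd {sz}.
have in_primes s : prime s -> s %| l -> s \in primes l.
  by move=> s_pr sl; rewrite mem_primes s_pr l0.
have big3 s : s \in primes l -> prime s /\ ((s == 3) || (5 <= s)).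
  rewrite mem_primes => /and3P[s_pr _ sl]; split => //.
  have so : odd s by apply: dvdn_odd sl l_odd.
  by have := prime_gt1 s_pr; case: (s) so => [|[|[|[|[|]]]]].
have := sorted_primes l; case E : (primes l) sz => [|s [|t [|? ?]]] // _ /=.
(* When [l] has no prime divisor other than 3, the prime 5 serves as a placeholder. *)
- by left; exists 5; split => // s s_pr sl; have := in_primes s s_pr sl; rewrite E.
- have [|s_pr /orP[/eqP s3|s5]] := big3 s; first by rewrite E inE.
    by left; exists 5; split => // u u_pr ul; have := in_primes u u_pr ul; rewrite E inE s3 => ->.
  by left; exists s; split => // u u_pr ul; have := in_primes u u_pr ul; rewrite E inE orbC => ->.
rewrite andbT => st; have [|s_pr s5] := big3 s; first by rewrite E inE eqxx.
have [|t_pr t5] := big3 t; first by rewrite E !inE eqxx orbT.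
have H u : prime u -> u %| l -> (u == s) || (u == t).
  by move=> u_pr ul; have := in_primes u u_pr ul; rewrite E !inE.
have [s3|s3] := eqVneq s 3.
  left; exists t; split => //; first by lia.
  by move=> u u_pr ul; rewrite -s3; apply: H.
right; exists s, t; split => //; first by lia.
have t6 : t != 6 by apply: contraL t_pr => /eqP->.
by lia.
Qed.

(** * Comparison of logarithms *)

Section Logarithms.
Local Open Scope R_scope.

Lemma ln_tangent (a b : R) : 0 < a -> 0 < b -> ln b <= ln a + b / a - 1.
Proof.
move=> a0 b0; have ba0 : 0 < b / a by apply: Rdiv_lt_0_compat.
have -> : b = a * (b / a) by field; lra.
rewrite ln_mult // (_ : a * (b / a) / a = b / a); last by field; lra.
have := exp_ineq1_le (ln (b / a)); rewrite exp_ln //; lra.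
Qed.

Definition lnn (n : nat) : R := ln (INR n).

Lemma INR_pos n : (0 < n)%N -> 0 < INR n.
Proof. by move=> n0; apply: lt_0_INR; apply/ltP. Qed.

Lemma INR_leq a b : (a <= b)%N -> INR a <= INR b.
Proof. by move=> ab; apply: le_INR; apply/leP. Qed.

Lemma INRM a b : INR (a * b)%N = INR a * INR b.
Proof. exact: mult_INR. Qed.

Lemma INRD a b : INR (a + b)%N = INR a + INR b.
Proof. exact: plus_INR. Qed.

Lemma lnnM a b : (0 < a)%N -> (0 < b)%N -> lnn (a * b) = lnn a + lnn b.
Proof. by move=> a0 b0; rewrite /lnn INRM ln_mult //; apply: INR_pos. Qed.

Lemma lnn_leq a b : (0 < a)%N -> (a <= b)%N -> lnn a <= lnn b.
Proof.
move=> a0 ab; have H := INR_leq ab.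
case: H => [H|H]; first by left; apply: ln_increasing => //; apply: INR_pos.
by right; rewrite /lnn H.
Qed.

Lemma lnn1 : lnn 1 = 0.
Proof. by rewrite /lnn /= ln_1. Qed.

Lemma lnn_ge0 a : (0 < a)%N -> 0 <= lnn a.
Proof. by move=> a0; rewrite -lnn1; apply: lnn_leq. Qed.

Lemma lnnX a n : (0 < a)%N -> lnn (a ^ n) = INR n * lnn a.
Proof.
move=> a0; elim: n => [|n IH]; first by rewrite expn0 lnn1 /=; lra.
by rewrite expnS lnnM ?expn_gt0 ?a0 // IH S_INR; lra.
Qed.

(** Weak Stirling bounds by induction, from [k ln (1 + 1/k) <= 1 <= (k + 1) ln (1 + 1/k)]. *)
Lemma lnn_fact_bounds n : (0 < n)%N ->
  INR n * lnn n - INR n <= lnn n`! <= INR n * lnn n - INR n + 1 + lnn n.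
Proof.
elim: n => // -[|n] IH _; first by rewrite (_ : 1`! = 1%N) // lnn1 /=; lra.
rewrite factS lnnM ?fact_gt0 // S_INR; have {IH} := IH isT.
set k := INR n.+1; have k0 : 0 < k by apply: INR_pos.
have -> : lnn n.+2 = ln (k + 1) by rewrite /lnn S_INR.
have -> : lnn n.+1 = ln k by [].
have T1 : k * (ln (k + 1) - ln k) <= 1.
  have := @ln_tangent k (k + 1) k0 ltac:(lra).
  rewrite (_ : (k + 1) / k = 1 + / k); last by field; lra.
  move=> H; apply: (Rle_trans _ (k * / k)); last by right; field; lra.
  by apply: Rmult_le_compat_l; lra.
have T2 : 1 <= (k + 1) * (ln (k + 1) - ln k).
  have := @ln_tangent (k + 1) k ltac:(lra) k0.
  rewrite (_ : k / (k + 1) = 1 - / (k + 1)); last by field; lra.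
  move=> H; apply: (Rle_trans _ ((k + 1) * / (k + 1))); first by right; field; lra.
  by apply: Rmult_le_compat_l; lra.
move=> [H1 H2]; split; nra.
Qed.

(** * Size of the products over residue classes modulo 3 *)

Lemma class_prod_recr c y :
  class_prod c y.+1 = (class_prod c y * (if y.+1 %% 3 == c then y.+1 else 1))%N.
Proof. by rewrite /class_prod big_mkcond big_nat_recr //= -big_mkcond. Qed.

Lemma class_prodS c j : class_prod c (3 * j.+1) =
  (class_prod c (3 * j) * ((if c == 1 then 3 * j + 1 else 1) *
     (if c == 2 then 3 * j + 2 else 1) * (if c == 0 then 3 * j + 3 else 1)))%N.
Proof.
rewrite (_ : (3 * j.+1)%N = (3 * j).+3); last by lia.
rewrite !class_prod_recr -!mulnA.
have -> : ((3 * j).+1 %% 3 = 1)%N by lia.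
have -> : ((3 * j).+2 %% 3 = 2)%N by lia.
have -> : ((3 * j).+3 %% 3 = 0)%N by lia.
by rewrite ![_ == c]eq_sym addn1 addn2 addn3.
Qed.

Lemma class_prod_fact j :
  (class_prod 1 (3 * j) * class_prod 2 (3 * j) * (3 ^ j * j`!))%N = (3 * j)`!.
Proof.
elim: j => [|j IH]; first by rewrite /class_prod muln0 !big_geq.
rewrite !class_prodS /= !muln1 !mul1n (_ : (3 * j.+1)%N = (3 * j).+3); last by lia.
rewrite !factS -IH expnS addn1 addn2 (_ : (3 * j).+3 = 3 * j.+1)%N; last by lia.
lia.
Qed.

Lemma class_prod_leq j : (class_prod 1 (3 * j) <= class_prod 2 (3 * j))%N.
Proof.
elim: j => [|j IH]; first by rewrite /class_prod muln0 !big_geq.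
by rewrite !class_prodS /= !muln1 !mul1n leq_mul // leq_add2l.
Qed.

(** Each [3i + 2] is paired with the next term [3i + 4] of the other class; the last partner is
    [3j + 1]. *)
Lemma class_prod_geq j : (class_prod 2 (3 * j) <= (3 * j + 1) * class_prod 1 (3 * j))%N.
Proof.
elim: j => [|j IH]; first by rewrite /class_prod muln0 !big_geq.
rewrite !class_prodS /= !muln1 !mul1n; apply: leq_trans (leq_mul IH (leqnn _)) _.
rewrite mulnC [(_ * class_prod 1 _)%N]mulnC; apply: leq_mul => //; lia.
Qed.

Definition class_ln (c k x : nat) : R := lnn (class_prod c (x %/ k)).

(** With [j = c m] one has [x / k = 3 j], and the two classes multiply to [(3 j)! / (3 ^ j j!)].
    Stirling's main terms combine to [2 j (ln (x / k) - 1)]. *)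
Lemma class_ln_bounds x m k c : x = (1080 * m)%N -> (0 < m)%N -> (k * c = 360)%N ->
  - (1 + lnn x) <=
    class_ln 1 k x + class_ln 2 k x - 2 * INR c * INR m * (lnn x - lnn k - 1) <= 1 + lnn x.
Proof.
move=> Dx m0 kc; have k0 : (0 < k)%N by case: (k) kc.
have c0 : (0 < c)%N by case: (c) kc => //; rewrite muln0.
have j0 : (0 < c * m)%N by rewrite muln_gt0 c0.
have Ex : x = (k * (3 * (c * m)))%N by rewrite Dx (_ : 1080 = 3 * 360)%N // -kc; lia.
have Ej : (x %/ k = 3 * (c * m))%N by rewrite Ex mulKn.
rewrite /class_ln Ej.
have E : lnn (class_prod 1 (3 * (c * m))) + lnn (class_prod 2 (3 * (c * m))) +
    (INR (c * m) * lnn 3 + lnn (c * m)`!) = lnn (3 * (c * m))`!.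
  by rewrite -class_prod_fact !lnnM ?muln_gt0 ?class_prod_gt0 ?expn_gt0 ?fact_gt0 // lnnX.
have := lnn_fact_bounds j0.
have j30 : (0 < 3 * (c * m))%N by rewrite muln_gt0.
have := lnn_fact_bounds j30.
have Ex3 : lnn x = lnn k + lnn (3 * (c * m)) by rewrite Ex lnnM.
have k_ge0 := lnn_ge0 k0.
have lj_ge0 : 0 <= lnn (c * m) by apply: lnn_ge0.
have three_ge0 : 0 <= lnn 3 by apply: lnn_ge0.
have E3 : lnn (3 * (c * m)) = lnn 3 + lnn (c * m) by rewrite lnnM.
rewrite Ex3 E3 [INR (3 * _)]INRM (_ : INR 3 = 3) -?INRM; last by rewrite /=; lra.
rewrite (_ : 2 * INR c * INR m = 2 * INR (c * m)); last by rewrite INRM; lra.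
set J := INR (c * m) in E *; set lj := lnn (c * m) in E lj_ge0 *; set l3 := lnn 3 in E three_ge0 *.
move: E; set L1 := lnn (class_prod 1 _); set L2 := lnn (class_prod 2 _).
set F3 := lnn (_`!); set F := lnn (_`!) => E [H1 H2] [H3 H4].
split; lra.
Qed.

Lemma class_ln_leq x m k c : x = (1080 * m)%N -> (0 < m)%N -> (k * c = 360)%N ->
  class_ln 1 k x <= class_ln 2 k x.
Proof.
move=> Dx m0 kc; have k0 : (0 < k)%N by case: (k) kc.
rewrite /class_ln (_ : x %/ k = 3 * (c * m))%N.
  by apply: lnn_leq; [apply: class_prod_gt0 | apply: class_prod_leq].
by rewrite Dx (_ : 1080 = 3 * 360)%N // -kc (_ : _ * m = k * (3 * (c * m)))%N ?mulKn //; lia.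
Qed.

Lemma class_ln_geq x m k c : x = (1080 * m)%N -> (0 < m)%N -> (k * c = 360)%N -> (1 < k)%N ->
  class_ln 2 k x <= class_ln 1 k x + lnn x.
Proof.
move=> Dx m0 kc k1; have k0 : (0 < k)%N by case: (k) kc.
have c0 : (0 < c)%N by case: (c) kc => //; rewrite muln0.
have j0 : (0 < c * m)%N by rewrite muln_gt0 c0.
have Ex : x = (k * (3 * (c * m)))%N by rewrite Dx (_ : 1080 = 3 * 360)%N // -kc; lia.
rewrite /class_ln (_ : x %/ k = 3 * (c * m))%N; last by rewrite Ex mulKn.
rewrite Rplus_comm -lnnM ?class_prod_gt0 //; last by rewrite Dx muln_gt0.
apply: lnn_leq; first exact: class_prod_gt0.
apply: leq_trans (class_prod_geq _) _; rewrite leq_mul2r; apply/orP; right.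
by rewrite Ex; move: (c * m)%N j0 => j j0; nia.
Qed.

Lemma lnn_list_prod_nil x : lnn (list_prod [::] x) = 0.
Proof. by rewrite /list_prod big_nil lnn1. Qed.

Lemma lnn_list_prod_cons c k L x :
  lnn (list_prod ((c, k) :: L) x) = class_ln c k x + lnn (list_prod L x).
Proof. by rewrite /list_prod big_cons lnnM // ?class_prod_gt0 //; apply: list_prod_gt0. Qed.

(** * Numerical bounds for logarithms *)

Lemma ln_pow_leq (a b : Z) (i j : nat) : Z.lt 0 a -> Z.lt 0 b ->
  Z.le (a ^ Z.of_nat i) (b ^ Z.of_nat j) -> INR i * ln (IZR a) <= INR j * ln (IZR b).
Proof.
move=> a0 b0 /IZR_le; rewrite -!pow_IZR => H.
have [A B] : 0 < IZR a /\ 0 < IZR b by split; apply: IZR_lt.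
rewrite -!ln_pow //; case: H => [H|->]; last by right.
by left; apply: ln_increasing => //; apply: pow_lt.
Qed.

Lemma lnnE n : lnn n = ln (IZR (Z.of_nat n)).
Proof. by rewrite /lnn INR_IZR_INZ. Qed.

Lemma ln3_ge1 : 1 <= lnn 3.
Proof.
rewrite lnnE -[1]ln_exp; have := exp_le_3; have := exp_pos 1.
by move=> e0 [H|->]; [left; apply: ln_increasing | right].
Qed.

Lemma ln2_bounds : 3 / 5 <= lnn 2 <= 1.
Proof.
have H3 := ln3_ge1.
have := @ln_tangent 1 2 ltac:(lra) ltac:(lra); rewrite ln_1 => H2.
(* [27 <= 32] and [1 <= ln 3] give the lower bound [3 / 5]. *)
have := @ln_pow_leq 3 2 3 5 erefl erefl ltac:(by vm_compute).
by move: H3; rewrite !lnnE /=; lra.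
Qed.

(** Close rational approximations, each an inequality between integer powers, reduce all logarithms
    to [ln 2] in the final linear comparison. *)
Lemma ln_ratio_bounds :
  [/\ 84 * lnn 2 <= 53 * lnn 3, 41 * lnn 3 <= 65 * lnn 2,
      65 * lnn 2 <= 28 * lnn 5, 31 * lnn 5 <= 72 * lnn 2 & 26 * lnn 7 <= 73 * lnn 2].
Proof.
rewrite !lnnE /=.
split.
- by have := @ln_pow_leq 2 3 84 53 erefl erefl ltac:(by vm_compute); rewrite !INR_IZR_INZ.
- by have := @ln_pow_leq 3 2 41 65 erefl erefl ltac:(by vm_compute); rewrite !INR_IZR_INZ.
- by have := @ln_pow_leq 2 5 65 28 erefl erefl ltac:(by vm_compute); rewrite !INR_IZR_INZ.
- by have := @ln_pow_leq 5 2 31 72 erefl erefl ltac:(by vm_compute); rewrite !INR_IZR_INZ.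
- by have := @ln_pow_leq 7 2 26 73 erefl erefl ltac:(by vm_compute); rewrite !INR_IZR_INZ.
Qed.

Lemma INR_div_leq x d : (0 < d)%N -> INR (x %/ d) <= INR x / INR d.
Proof.
move=> d0; have d0' := INR_pos d0; apply: (Rmult_le_reg_r (INR d)) => //.
rewrite /Rdiv Rmult_assoc Rinv_l ?Rmult_1_r -?INRM; last by lra.
by apply: INR_leq; apply: leq_divM.
Qed.

Lemma lnnX4 a : (0 < a)%N -> lnn (a ^ 4) = 4 * lnn a.
Proof. by move=> a0; rewrite lnnX // /=; lra. Qed.

Lemma INR_add2 a : INR (a + 2)%N = INR a + 2.
Proof. by rewrite INRD /=; lra. Qed.

(** By [ln_tangent] at [24 q0], the bound [(x / 12q) (4 ln (24 q) + ln 720)] is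
    largest at [q = q0] among the [q >= q0]. *)
Lemma bad_class_ln x q q0 c : prime q -> (5 <= q0 <= q)%N -> (8 <= x)%N ->
  4 * lnn (bad_class x q c) <=
    INR x / (12 * INR q0) * (4 * lnn (24 * q0) + lnn 720) + 2 * (4 * lnn (24 * x) + lnn 720).
Proof.
move=> q_pr /andP[q05 q0q] x8.
have q5 : (5 <= q)%N by apply: leq_trans q0q.
have q0_gt0 : (0 < q0)%N by apply: leq_trans q05.
have q_gt0 : (0 < q)%N by apply: leq_trans q5.
have x_gt0 : (0 < x)%N by apply: leq_trans x8.
have [Q0 Q X] : [/\ 0 < INR q0, 0 < INR q & 0 < INR x] by split; apply: INR_pos.
have L720 : 0 <= lnn 720 by apply: lnn_ge0.
have L24 y : (0 < y)%N -> 0 <= lnn (24 * y) by move=> y0; apply: lnn_ge0; rewrite muln_gt0.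
have B0 : 0 <= INR x / (12 * INR q0) by apply: Rlt_le; apply: Rdiv_lt_0_compat; lra.
have [xq|qx] := ltnP x q.
  rewrite bad_class_large // lnn1.
  have := Rmult_le_pos _ _ B0 (_ : 0 <= 4 * lnn (24 * q0) + lnn 720).
  by have := L24 _ q0_gt0; have := L24 _ x_gt0; lra.
have b0 : (0 < bad_class x q c)%N by apply: prime_prod_gt0.
have := bad_class_leq c q_pr q5 x8.
move/(lnn_leq _); rewrite expn_gt0 b0 => /(_ isT).
have K0 : (0 < (24 * q) ^ 4 * 720)%N by rewrite muln_gt0 expn_gt0 muln_gt0 q_gt0.
rewrite [lnn (bad_class _ _ _ ^ 4)]lnnX4 // [lnn (_ ^ (_ + 2))]lnnX // INR_add2.
rewrite [lnn (_ * 720)]lnnM ?expn_gt0 ?muln_gt0 ?q_gt0 // lnnX4 ?muln_gt0 ?q_gt0 //.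
set A := 4 * lnn (24 * q) + lnn 720 => H.
have A0 : 0 <= A by have := L24 _ q_gt0; rewrite /A; lra.
have AX : A <= 4 * lnn (24 * x) + lnn 720.
  have : lnn (24 * q) <= lnn (24 * x) by apply: lnn_leq; rewrite ?leq_mul2l ?muln_gt0 ?q_gt0.
  by rewrite /A; lra.
have D : INR (x %/ (12 * q)) <= INR x / (12 * INR q).
  have := @INR_div_leq x (12 * q); rewrite muln_gt0 q_gt0 => /(_ isT).
  by rewrite INRM (_ : INR 12 = 12); [|rewrite /=; lra].
set K := 4 * lnn (24 * q0) + lnn 720.
have T : A <= K + 4 * (INR q / INR q0) - 4.
  have := ln_tangent (INR_pos (_ : 0 < 24 * q0)%N) (INR_pos (_ : 0 < 24 * q)%N).
  rewrite !muln_gt0 q0_gt0 q_gt0 => /(_ isT isT).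
  rewrite -/(lnn _) -/(lnn _) !INRM (_ : INR 24 * INR q / (INR 24 * INR q0) = INR q / INR q0).
    by rewrite /A /K; lra.
  by field; split; [lra | apply: Rgt_not_eq; apply: INR_pos].
have K4 : 4 <= K.
  have : lnn 3 <= lnn (24 * q0) by apply: lnn_leq => //; lia.
  by have := ln3_ge1; rewrite /K; lra.
have t1 : 1 <= INR q / INR q0.
  apply: (Rmult_le_reg_r (INR q0)) => //; rewrite /Rdiv Rmult_assoc Rinv_l ?Rmult_1_r; last by lra.
  by rewrite Rmult_1_l; apply: INR_leq.
(* Since [4 <= K] and the ratio is at least 1, [K + 4 (q / q0 - 1)] is at most [K (q / q0)]. *)
have AK : A <= K * (INR q / INR q0) by nra.
have D' : INR x / (12 * INR q) * A <= INR x / (12 * INR q0) * K.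
  apply: (Rle_trans _ (INR x / (12 * INR q) * (K * (INR q / INR q0)))).
    by apply: Rmult_le_compat_l => //; apply: Rlt_le; apply: Rdiv_lt_0_compat; lra.
  by right; field; lra.
have D'' := Rmult_le_compat_r _ _ _ A0 D.
lra.
Qed.

Lemma ln_certificate N D w Y1 Y2 t x s : certificate N D w Y1 Y2 t ->
  (0 < x)%N -> (x < s.+1 ^ 2)%N ->
  lnn (list_prod N x) <= lnn (list_prod D x) +
    lnn (prime_prod x.+1 (fun p => (x < 2 * p)%N && w (p %% 3))) +
    (INR x / INR Y1 + INR x / INR Y2) * lnn 4 + 2 * (INR s * lnn x).
Proof.
case/certificateP => HN HD Y1_gt1 Y2_gt1 H x0 xs.
have [Y1_gt0 Y2_gt0] : (0 < Y1)%N /\ (0 < Y2)%N by split; apply: ltnW.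
have := certificate_bound HN HD Y1_gt1 Y2_gt1 x0 xs H.
rewrite -/(prime_prod x.+1 (fun p => (x < 2 * p)%N && w (p %% 3))); set G := prime_prod _ _.
have G0 : (0 < G)%N by apply: prime_prod_gt0.
have [N0 D0] := (list_prod_gt0 N x, list_prod_gt0 D x).
move/(lnn_leq N0).
rewrite !lnnM ?muln_gt0 ?D0 ?G0 ?expn_gt0 ?x0 // !lnnX // INRM (_ : INR 2 = 2) //.
have l4 : 0 <= lnn 4 by apply: lnn_ge0.
have D1 := Rmult_le_compat_r _ _ _ l4 (INR_div_leq x Y1_gt0).
have D2 := Rmult_le_compat_r _ _ _ l4 (INR_div_leq x Y2_gt0).
lra.
Qed.

(** Tangents to [ln] at [2 ^ 12] and [2 ^ 24], with [ln 2 <= 1]. The constant 16776000 lies just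
    below [2 ^ 24 - 1080]. *)
Lemma error_bounds x s : 16776000 <= INR x -> (s ^ 2 <= x < s.+1 ^ 2)%N ->
  INR s * lnn x <= 59 / 10000 * INR x /\ lnn x <= INR x / 690000.
Proof.
move=> X /andP[sx xs]; have [_ l2] := ln2_bounds.
have x0 : (0 < x)%N by case: (x) X => //=; lra.
have S0 := pos_INR s.
have sx' : INR s * INR s <= INR x by rewrite -INRM mulnn; apply: INR_leq.
have xs' : INR x <= (INR s + 1) * (INR s + 1).
  by rewrite -S_INR -INRM mulnn; apply: INR_leq; apply: ltnW.
have S1 : 4094 <= INR s by nra.
have T1 : ln (INR s + 1) <= 11 + (INR s + 1) / 4096.
  have := @ln_tangent (2 ^ 12) (INR s + 1) ltac:(lra) ltac:(lra).
  rewrite ln_pow; last by lra.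
  have -> : ln 2 = lnn 2 by [].
  rewrite (_ : INR 12 = 12); last by rewrite /=; lra.
  by rewrite (_ : (2 : R) ^ 12 = 4096); lra.
have T2 : lnn x <= 2 * ln (INR s + 1).
  have -> : 2 * ln (INR s + 1) = ln ((INR s + 1) * (INR s + 1)) by rewrite ln_mult; lra.
  rewrite /lnn; case: xs' => [xs'|->]; last by right.
  by left; apply: ln_increasing => //; apply: INR_pos.
have T3 : lnn x <= 23 + INR x / 16777216.
  have := @ln_tangent (2 ^ 24) (INR x) ltac:(lra) (INR_pos x0).
  rewrite ln_pow; last by lra.
  have -> : ln 2 = lnn 2 by [].
  rewrite (_ : INR 24 = 24); last by rewrite /=; lra.
  by rewrite (_ : (2 : R) ^ 24 = 16777216) -?/(lnn x); lra.
split; last by lra.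
apply: (Rle_trans _ (INR s * (22 + (INR s + 1) / 2048))); last by nra.
by apply: Rmult_le_compat_l; lra.
Qed.

Lemma exists_sqrtn x : exists s, (s ^ 2 <= x < s.+1 ^ 2)%N.
Proof.
elim: x => [|x [s /andP[sx xs]]]; first by exists 0%N.
have [h|h] := ltnP x.+1 (s.+1 ^ 2); first by exists s; rewrite h andbT; apply: leqW.
exists s.+1; rewrite h /=; apply: leq_ltn_trans xs _.
by rewrite ltn_sqr.
Qed.

Lemma lnn_smooth :
  [/\ lnn 4 = 2 * lnn 2, lnn 10 = lnn 2 + lnn 5, lnn 6 = lnn 2 + lnn 3,
      lnn 720 = 4 * lnn 2 + 2 * lnn 3 + lnn 5 & lnn 24 = 3 * lnn 2 + lnn 3].
Proof.
have L4 : lnn 4 = lnn 2 + lnn 2 := @lnnM 2 2 isT isT.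
have L6 : lnn 6 = lnn 2 + lnn 3 := @lnnM 2 3 isT isT.
have L24 : lnn 24 = lnn 4 + lnn 6 := @lnnM 4 6 isT isT.
have L10 : lnn 10 = lnn 2 + lnn 5 := @lnnM 2 5 isT isT.
have L30 : lnn 30 = lnn 5 + lnn 6 := @lnnM 5 6 isT isT.
have L720 : lnn 720 = lnn 24 + lnn 30 := @lnnM 24 30 isT isT.
split; lra.
Qed.

Lemma bad_class_ln5 x q c : prime q -> (5 <= q)%N -> (8 <= x)%N ->
  4 * lnn (bad_class x q c) <= INR x * (16 * lnn 2 + 6 * lnn 3 + 5 * lnn 5) / 60 +
    2 * (16 * lnn 2 + 6 * lnn 3 + lnn 5 + 4 * lnn x).
Proof.
move=> q_pr q5 x8; have := @bad_class_ln x q 5 c q_pr.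
rewrite q5 => /(_ isT x8); have x0 : (0 < x)%N by apply: leq_trans x8.
rewrite !lnnM // (_ : INR 5 = 5); last by rewrite /=; lra.
have [_ _ _ -> ->] := lnn_smooth; rewrite (_ : 12 * 5 = 60); last by lra.
by move=> H; apply: (Rle_trans _ _ _ H); right; field.
Qed.

Lemma bad_class_ln7 x q c : prime q -> (7 <= q)%N -> (8 <= x)%N ->
  4 * lnn (bad_class x q c) <= INR x * (16 * lnn 2 + 6 * lnn 3 + lnn 5 + 4 * lnn 7) / 84 +
    2 * (16 * lnn 2 + 6 * lnn 3 + lnn 5 + 4 * lnn x).
Proof.
move=> q_pr q7 x8; have := @bad_class_ln x q 7 c q_pr.
rewrite q7 => /(_ isT x8); have x0 : (0 < x)%N by apply: leq_trans x8.
rewrite !lnnM // (_ : INR 7 = 7); last by rewrite /=; lra.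
have [_ _ _ -> ->] := lnn_smooth; rewrite (_ : 12 * 7 = 84); last by lra.
by move=> H; apply: (Rle_trans _ _ _ H); right; field.
Qed.

(** * Main terms of the certificates and the case of large [n] *)

Lemma class_ln_main x m k c (C : R) : x = (1080 * m)%N -> (0 < m)%N -> (k * c = 360)%N ->
  IZR (Z.of_nat c) = C ->
  - (1 + lnn x) <=
    class_ln 1 k x + class_ln 2 k x - 2 * C * INR m * (lnn x - lnn k - 1) <= 1 + lnn x.
Proof. by move=> Dx m0 kc <-; rewrite -INR_IZR_INZ; apply: class_ln_bounds. Qed.

(** Equal slopes cancel the terms in [m ln x], leaving a combination of the [ln k]. The unpaired
    entries [(2, 1)] and [(1, 4)] count as half of a pair, by comparison of the two classes. *)
Lemma certificateA_main x m : x = (1080 * m)%N -> (0 < m)%N ->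
  INR m * (114 * lnn 2 + 18 * lnn 3 + 60 * lnn 5) - 8 * (1 + lnn x) <=
    lnn (list_prod numA x) - lnn (list_prod denA x).
Proof.
move=> Dx m0; rewrite /numA /denA !lnn_list_prod_cons !lnn_list_prod_nil.
have B k c C := @class_ln_main x m k c C Dx m0.
have := B 1%N 360%N 360 erefl erefl; have := B 4%N 90%N 90 erefl erefl.
have := B 10%N 36%N 36 erefl erefl; have := B 24%N 15%N 15 erefl erefl.
have := B 60%N 6%N 6 erefl erefl; have := B 2%N 180%N 180 erefl erefl.
have := B 5%N 72%N 72 erefl erefl; have := B 12%N 30%N 30 erefl erefl.
have := class_ln_leq Dx m0 (erefl : (1 * 360 = 360)%N).
have := class_ln_geq Dx m0 (erefl : (4 * 90 = 360)%N) isT.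
have [L4 L10 L6 _ L24] := lnn_smooth.
have L12 : lnn 12 = lnn 2 + lnn 6 := @lnnM 2 6 isT isT.
have L60 : lnn 60 = lnn 10 + lnn 6 := @lnnM 10 6 isT isT.
rewrite L60 L12 L10 L24 L6 L4 lnn1.
lra.
Qed.

Lemma certificateB_main x m : x = (1080 * m)%N -> (0 < m)%N ->
  INR m * (284 * lnn 2 + 132 * lnn 3 + 70 * lnn 5) - 14 * (1 + lnn x) <=
    lnn (list_prod numB x) - lnn (list_prod denB x).
Proof.
move=> Dx m0; rewrite /numB /denB /both_classes /= !lnn_list_prod_cons !lnn_list_prod_nil.
have B k c C := @class_ln_main x m k c C Dx m0.
have := B 1%N 360%N 360 erefl erefl; have := B 4%N 90%N 90 erefl erefl.
have := B 10%N 36%N 36 erefl erefl; have := B 24%N 15%N 15 erefl erefl.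
have := B 36%N 10%N 10 erefl erefl; have := B 90%N 4%N 4 erefl erefl.
have := B 120%N 3%N 3 erefl erefl; have := B 180%N 2%N 2 erefl erefl.
have := B 2%N 180%N 180 erefl erefl; have := B 5%N 72%N 72 erefl erefl.
have := B 6%N 60%N 60 erefl erefl; have := B 18%N 20%N 20 erefl erefl.
have := B 45%N 8%N 8 erefl erefl.
have [L4 L10 L6 _ L24] := lnn_smooth.
have L18 : lnn 18 = lnn 6 + lnn 3 := @lnnM 6 3 isT isT.
have L36 : lnn 36 = lnn 6 + lnn 6 := @lnnM 6 6 isT isT.
have L90 : lnn 90 = lnn 18 + lnn 5 := @lnnM 18 5 isT isT.
have L45 : lnn 90 = lnn 2 + lnn 45 := @lnnM 2 45 isT isT.
have L120 : lnn 120 = lnn 24 + lnn 5 := @lnnM 24 5 isT isT.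
have L180 : lnn 180 = lnn 36 + lnn 5 := @lnnM 36 5 isT isT.
rewrite (_ : lnn 45 = 2 * lnn 3 + lnn 5); last by lra.
by rewrite L180 L120 L90 L36 L18 L24 L10 L6 L4 lnn1; lra.
Qed.

Lemma INR_num n z : Z.of_nat n = z -> INR n = IZR z.
Proof. by move=> <-; apply: INR_IZR_INZ. Qed.

Lemma good_prime_large l n : odd l -> (size (primes l) <= 2)%N -> (2 ^ 24 <= N.of_nat n)%num ->
  exists p, [/\ prime p, coprime l (p * p.-1), (p <= n)%N & (n < 2 * p)%N].
Proof.
move=> l_odd sz n24; have l0 : (0 < l)%N by case: l l_odd {sz}.
have [/existsP[p /and3P[p_pr co np]]|/existsPn none] :=
  boolP [exists p : 'I_n.+1, [&& prime p, coprime l (p * p.-1) & (n < 2 * p)%N]].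
  by exists p; split => //; rewrite -ltnS.
have noprime p : prime p -> (p <= n)%N -> (n < 2 * p)%N -> ~~ coprime l (p * p.-1).
  move=> p_pr pn np; have pn' : (p < n.+1)%N by [].
  by have := none (Ordinal pn'); rewrite /= p_pr np andbT.
(* Rounding down to a multiple of [1080 = 3 * 360] makes every [x / k] in the certificates a
   multiple of 3. *)
exfalso; pose m := (n %/ 1080)%N; pose x := (1080 * m)%N.
have nE := divn_eq n 1080; have n_mod : (n %% 1080 < 1080)%N by rewrite ltn_mod.
have xn : (x <= n)%N by rewrite [in X in (_ <= X)%N]nE mulnC leq_addr.
have nx : (n < x + 1080)%N by rewrite [in X in (X < _)%N]nE mulnC ltn_add2l.
have n_large : 16777216 <= INR n by rewrite INR_IZR_INZ; apply: IZR_le; lia.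
have XM : INR x = 1080 * INR m by rewrite INRM (@INR_num 1080 1080).
have X : 16776000 <= INR x.
  by have := INR_leq (ltnW nx); rewrite INRD (@INR_num 1080 1080) //; lra.
have x8 : (8 <= x)%N.
  by rewrite leqNgt; apply/negP => /ltnW/INR_leq; rewrite (@INR_num 8 8) //; lra.
have m0 : (0 < m)%N by move: x8; rewrite /x; case: (m).
have x0 : (0 < x)%N by apply: leq_trans x8.
have Dx : x = (1080 * m)%N by [].
clearbody x.
have [s sx] := exists_sqrtn x; have /andP[_ xs] := sx.
have [E1 E2] := error_bounds X sx.
have [L4 _ _ _ _] := lnn_smooth; have [l2 l2'] := ln2_bounds.
have [R1 R2 R3 R4 R5] := ln_ratio_bounds.
have M0 : 0 <= INR m by apply: pos_INR.
(* The products of [INR m] with logarithms are atoms for [lra], so the numerical bounds are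
   multiplied by [INR m] beforehand. *)
have M2 := Rmult_le_compat_l _ _ _ M0 l2.
have {R1}R1' := Rmult_le_compat_l _ _ _ M0 R1.
have R2' := Rmult_le_compat_l _ _ _ M0 R2.
have R3' := Rmult_le_compat_l _ _ _ M0 R3.
have R4' := Rmult_le_compat_l _ _ _ M0 R4.
have R5' := Rmult_le_compat_l _ _ _ M0 R5.
have [[r [r_pr r5 lr]]|[q [r [q_pr r_pr q5 r7 lqr]]]] := odd_primes_cover l_odd sz.
(* After subtracting tails and errors, the lower bound is about [0.129 x], against an upper bound of
   about [0.108 x]. *)
- have := ln_certificate certificateA x0 xs; set G := prime_prod _ _ => C.
  have G0 : (0 < G)%N by apply: prime_prod_gt0.
  have : (G <= x ^ 541 * bad_class x r 5)%N := prime_prod_le_A l0 x8 xn nx noprime r_pr r5 lr.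
  move/(lnn_leq G0).
  rewrite lnnM ?expn_gt0 ?x0 ?prime_prod_gt0 // lnnX // (@INR_num 541 541) // => HG.
  move: C; rewrite (@INR_num 49 49) // (@INR_num 121 121) // L4 => C.
  have HA := certificateA_main Dx m0.
  have HB := bad_class_ln5 5 r_pr r5 x8.
  rewrite XM in E1 E2 C HB.
  lra.
(* Here about [0.39 x] stands against about [0.377 x]. The gain from [r >= 7] is essential: the
   estimate with 5 for both primes would give about [0.43 x]. *)
have := ln_certificate certificateB x0 xs; set G := prime_prod _ _ => C.
have G0 : (0 < G)%N by apply: prime_prod_gt0.
have : (G <= x ^ 542 * (bad_class x q 1 * bad_class x q 5 *
    (bad_class x r 1 * bad_class x r 5)))%N.
  by apply: (prime_prod_le_B l0 x8 xn nx noprime q_pr r_pr q5 _ lqr); apply: leq_trans r7.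
move/(lnn_leq G0).
rewrite lnnM ?muln_gt0 ?expn_gt0 ?x0 ?prime_prod_gt0 // lnnX // (@INR_num 542 542) //.
have lnn4 a b c d : (0 < a)%N -> (0 < b)%N -> (0 < c)%N -> (0 < d)%N ->
    lnn (a * b * (c * d)) = lnn a + lnn b + (lnn c + lnn d).
  by move=> a0 b0 c0 d0; rewrite !lnnM ?muln_gt0 ?a0 ?b0 ?c0.
rewrite lnn4 ?prime_prod_gt0 // => HG.
move: C; rewrite (@INR_num 181 181) // (@INR_num 121 121) // L4 => C.
have HA := certificateB_main Dx m0.
have HB1 := bad_class_ln5 1 q_pr q5 x8; have HB2 := bad_class_ln5 5 q_pr q5 x8.
have HB3 := bad_class_ln7 1 r_pr r7 x8; have HB4 := bad_class_ln7 5 r_pr r7 x8.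
rewrite XM in E1 E2 C HB1 HB2 HB3 HB4.
lra.
Qed.

End Logarithms.

Theorem theorem1 (l n : nat) (hl : 0 < l) (hodd : odd l)
  (hprimes : size (primes l) <= 2) (hn : 0 < n) :
  ~ powerful (Omega l n).
Proof.
have [n21|n21] := leqP n 21; first exact: not_powerful_small.
have [p [p_pr co pn np]] : exists p,
    [/\ prime p, coprime l (p * p.-1), p <= n.+1 & n.+1 < 2 * p].
  have [lt|ge] := N.lt_ge_cases (N.of_nat n.+1) (2 ^ 24).
    (* Now [n >= 22], so [n.+1] reaches the starting point 23 of the chain. *)
    by apply: good_prime_small => //; lia.
  exact: good_prime_large.
exact: not_powerful_of_prime p_pr co pn np.
Qed.
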